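(* Let $a>b>0$ and $\rho\in[0,\tfrac12]$ be fixed, let $K=\lceil \rho n\rceil$, and consider the binary asymmetric stochastic block model (defined in the context) with clusters of sizes $K$ and $n-K$. Let $\widehat Y_{\mathrm{SDP}}$ be the solution of $$\max_{Y}\ \langle A,Y\rangle\quad\text{s.t.}\quad Y\succeq 0,\ \ Y_{ii}=1\ (i\in[n]),\ \ \langle \mathbf J,Y\rangle=(2K-n)^2 .$$ If $\eta(\rho,a,b)>1$, then $$\min_{Y^*\in\mathcal Y_n}\mathbb P\{\widehat Y_{\mathrm{SDP}}=Y^*\}\ \ge\ 1-n^{-\Omega(1)}\quad\text{as } n\to\infty,$$ where $\widehat Y_{\mathrm{SDP}}=Y^*$ means that $Y^*$ is the unique optimal solution of the SDP.
   Context: Binary asymmetric SBM: there are $n$ vertices and a true labeling $\sigma^*\in\{\pm1\}^n$ with $(\sigma^* )^\top\mathbf 1=2K-n$ (so cluster $C_1^*=\{i:\sigma^*_i=1\}$ has $K$ vertices and $C_2^*$ has $n-K$). A random graph is generated with each pair $\{i,j\}$ independently connected with probability $p=a\log n/n$ if $\sigma^*_i=\sigma^*_j$ and $q=b\log n/n$ otherwise; $A$ is its (symmetric, zero-diagonal, $0/1$) adjacency matrix. $Y^*=\sigma^*(\sigma^* )^\top$ and $\mathcal Y_n=\{\sigma\sigma^\top:\sigma\in\{\pm1\}^n,\ \sigma^\top\mathbf 1=2K-n\}$. $\mathbf J$ is the all-ones matrix, $\mathbf 1$ the all-ones vector. Define $\bar\rho=1-\rho$, $\tau=\frac{a-b}{\log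 a-\log b}$, $\gamma=\sqrt{(\bar\rho-\rho)^2\tau^2+4\rho\bar\rho ab}$, and for $\rho\in(0,1)$ $$\eta(\rho,a,b)=\frac{a+b}{2}-\gamma+\frac{(\bar\rho-\rho)\tau}{2}\log\frac{\rho(\gamma+(\bar\rho-\rho)\tau)}{\bar\rho(\gamma-(\bar\rho-\rho)\tau)},$$ with $\eta(0,a,b)=\lim_{\rho\to0}\eta(\rho,a,b)=\frac{a+b}{2}-\tau\log\frac{e\sqrt{ab}}{\tau}$. Logarithms are natural. *)

(* Defs.v *)
From mathcomp Require Import all_boot.
From Stdlib Require Import Reals ClassicalEpsilon.
Set Implicit Arguments. Unset Strict Implicit. Unset Printing Implicit Defensive.

Open Scope R_scope.

Definition sgn (b : bool) : R := if b then 1 else -1.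

(* eta(rho,a,b), with eta(0,a,b) defined as the limit value *)
Definition tau (a b : R) : R := (a - b) / (ln a - ln b).
Definition gam (rho a b : R) : R :=
  sqrt (((1 - rho) - rho) ^ 2 * (tau a b) ^ 2 + 4 * rho * (1 - rho) * a * b).
Definition eta (rho a b : R) : R :=
  if Req_EM_T rho 0 then
    (a + b) / 2 - tau a b * ln (exp 1 * sqrt (a * b) / tau a b)
  else
    (a + b) / 2 - gam rho a b
    + ((1 - rho) - rho) * tau a b / 2 *
      ln (rho * (gam rho a b + ((1 - rho) - rho) * tau a b)
          / ((1 - rho) * (gam rho a b - ((1 - rho) - rho) * tau a b))).

(* A graph on vertex set 'I_n is given by its 0/1 adjacency matrix, encoded as a
   boolean function on pairs; only symmetric, zero-diagonal ones have positive mass. *)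
Definition graph (n : nat) := {ffun 'I_n * 'I_n -> bool}.

Definition adj_valid n (A : graph n) : bool :=
  [forall i : 'I_n, ~~ A (i, i)] && [forall i : 'I_n, forall j : 'I_n, A (i, j) == A (j, i)].

Definition adjR n (A : graph n) (i j : 'I_n) : R := if A (i, j) then 1 else 0.

Definition edge_prob n (a b : R) (sigma : 'I_n -> bool) (i j : 'I_n) : R :=
  if sigma i == sigma j then a * ln (INR n) / INR n else b * ln (INR n) / INR n.

Definition sbm_mass n (a b : R) (sigma : 'I_n -> bool) (A : graph n) : R :=
  if adj_valid A then
    \big[Rmult/1]_(i : 'I_n) \big[Rmult/1]_(j : 'I_n | ltn i j)
       (if A (i, j) then edge_prob a b sigma i j else 1 - edge_prob a b sigma i j)
  else 0.

Definition sbm_prob n (a b : R) (sigma : 'I_n -> bool) (E : graph n -> Prop) : R :=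
  \big[Rplus/0]_(A : graph n)
     (if excluded_middle_informative (E A) then sbm_mass a b sigma A else 0).

Definition psd n (Y : 'I_n -> 'I_n -> R) : Prop :=
  (forall i j, Y i j = Y j i) /\
  (forall x : 'I_n -> R,
      0 <= \big[Rplus/0]_(i : 'I_n) \big[Rplus/0]_(j : 'I_n) (x i * Y i j * x j)).

Definition sdp_feasible n (K : nat) (Y : 'I_n -> 'I_n -> R) : Prop :=
  psd Y /\ (forall i, Y i i = 1) /\
  \big[Rplus/0]_(i : 'I_n) \big[Rplus/0]_(j : 'I_n) Y i j = (2 * INR K - INR n) ^ 2.

Definition sdp_obj n (A : graph n) (Y : 'I_n -> 'I_n -> R) : R :=
  \big[Rplus/0]_(i : 'I_n) \big[Rplus/0]_(j : 'I_n) (adjR A i j * Y i j).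

Definition sdp_unique_opt n (K : nat) (A : graph n) (Ystar : 'I_n -> 'I_n -> R) : Prop :=
  sdp_feasible K Ystar /\
  forall Y, sdp_feasible K Y -> (exists i j, Y i j <> Ystar i j) ->
    sdp_obj A Y < sdp_obj A Ystar.

Definition outer n (sigma : 'I_n -> bool) : 'I_n -> 'I_n -> R :=
  fun i j => sgn (sigma i) * sgn (sigma j).

(* Main.v *)
(** The certificate of optimality of [Y* = sigma sigma^T] is the slack matrix
    [S = diag(d) - A + lam J] with [lam = tau ln n / n] and [d] chosen so that [S sigma = 0]: weak
    duality makes [Y*] the unique optimum as soon as [x^T S x > 0] for all nonzero [x] orthogonal to
    [sigma].  The quadratic form is bounded below by (i) [min d_i >= e0 ln n], a Chernoff bound
    whose optimal exponent is exactly [eta] on both clusters, hence a union bound over [n] vertices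
    because [eta > 1]; (ii) [|x^T (A - E A) x| <= eps ln n |x|^2] for an arbitrarily small constant
    [eps]; (iii) the direction constant on the clusters, which contributes [(tau - b) ln n] in the
    mean.  For (ii) no sharp random matrix theory is needed: a vector with entries
    [O(|x| / sqrt n)] is a mixture of sign vectors, handled by a union bound over [2^n] of them,
    and the vertices of the few large entries have degree [O(ln n)] and span a sparse subgraph. *)

From HB Require Import structures.
Require Import Defs.
From mathcomp Require Import all_boot.
From Stdlib Require Import Reals Lra ClassicalEpsilon.
Set Implicit Arguments. Unset Strict Implicit. Unset Printing Implicit Defensive.
Open Scope R_scope.

(** * Finite sums and products of real numbers *)

(** The multiplier of the constraint on [<J, Y>] is one scalar that has to serve two clusters: when
    [K < n / 2], raising [lam] raises [d_i] on the small cluster and lowers it on the large one. The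
    value [tau] balances the two large-deviation rates: the optimal tilts on the two clusters
    multiply to [a / b], and [tau (ln a - ln b) = a - b] then turns one rate into the other. The
    lower bound on [d_i] is only a small multiple [e0 ln n], whereas along the cluster-constant
    direction [lam J - E A] contributes a term of order [ln n] that can be negative. The minimum of
    the [d_i] cannot pay for it; their expectation, which is constant on each cluster and of the
    right size, does. This argument divides by the cluster sizes and needs both proportional to [n].
    For [rho = 0] rounding gives [K = 0] and the feasible set is a single point, so that case is
    settled apart, with probability one. *)

HB.instance Definition _ := Monoid.isComLaw.Build R 0 Rplus
  (fun x y z => esym (Rplus_assoc x y z)) Rplus_comm Rplus_0_l.
HB.instance Definition _ := Monoid.isComLaw.Build R 1 Rmult
  (fun x y z => esym (Rmult_assoc x y z)) Rmult_comm Rmult_1_l.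
HB.instance Definition _ := Monoid.isMulLaw.Build R 0 Rmult Rmult_0_l Rmult_0_r.
HB.instance Definition _ := Monoid.isAddLaw.Build R Rmult Rplus
  (fun x y z => Rmult_plus_distr_r x y z) (fun x y z => Rmult_plus_distr_l x y z).

Notation "\rsum_ i F" := (\big[Rplus/0]_i F)
  (at level 36, i at level 0, F at level 36, right associativity).

Lemma Rsum_le (I : finType) (P : pred I) (F G : I -> R) :
  (forall i, P i -> F i <= G i) ->
  \big[Rplus/0]_(i | P i) F i <= \big[Rplus/0]_(i | P i) G i.
Proof.
move=> le_FG; elim/big_ind2: _ => //; first lra.
by move=> x1 x2 y1 y2 h1 h2; lra.
Qed.

Lemma Rsum_ge0 (I : finType) (P : pred I) (F : I -> R) :
  (forall i, P i -> 0 <= F i) -> 0 <= \big[Rplus/0]_(i | P i) F i.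
Proof. by move=> F0; elim/big_ind: _ => //; [lra | move=> x y; lra]. Qed.

Lemma Rsum_subset_le (I : finType) (P : pred I) (F : I -> R) :
  (forall i, 0 <= F i) -> \big[Rplus/0]_(i | P i) F i <= \rsum_i F i.
Proof.
move=> F0; rewrite big_mkcond /=; apply: Rsum_le => i _.
by case: ifP => _; have := F0 i; lra.
Qed.

Lemma Rsum_term_le (I : finType) (F : I -> R) (k : I) :
  (forall i, 0 <= F i) -> F k <= \rsum_i F i.
Proof.
move=> F0; rewrite (bigD1 k) //=.
have : 0 <= \big[Rplus/0]_(i | i != k) F i by apply: Rsum_ge0 => i _; exact: F0.
lra.
Qed.

Lemma Rabs_sum_le (I : finType) (F : I -> R) :
  Rabs (\rsum_i F i) <= \rsum_i Rabs (F i).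
Proof.
elim/big_ind2: _ => //; first by rewrite Rabs_R0; lra.
  by move=> x1 x2 y1 y2 h1 h2; have := Rabs_triang x2 y2; lra.
by move=> i _; lra.
Qed.

Lemma Rsum_const (I : finType) (P : pred I) (c : R) :
  \big[Rplus/0]_(i | P i) c = INR #|P| * c.
Proof.
rewrite big_const; elim: #|P| => [|m IH]; first by rewrite /=; lra.
by rewrite iterS IH S_INR; lra.
Qed.

Lemma Rsum_const_ord n (c : R) : \big[Rplus/0]_(i : 'I_n) c = INR n * c.
Proof. by rewrite Rsum_const card_ord. Qed.

Lemma Rsum_opp (I : finType) (F : I -> R) : \rsum_i (- F i) = - \rsum_i F i.
Proof. by elim/big_rec2: _ => [|i x y _ ->]; lra. Qed.

Lemma Rsum_sub (I : finType) (F G : I -> R) :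
  \rsum_i (F i - G i) = \rsum_i F i - \rsum_i G i.
Proof. by rewrite /Rminus big_split /= Rsum_opp. Qed.

Lemma Rsum_mulr (I : finType) (F : I -> R) (c : R) :
  \rsum_i (F i * c) = (\rsum_i F i) * c.
Proof. by rewrite big_distrl. Qed.

Lemma Rsum_mull (I : finType) (F : I -> R) (c : R) :
  \rsum_i (c * F i) = c * \rsum_i F i.
Proof. by rewrite big_distrr. Qed.

Lemma Rsum_if (I : finType) (P : pred I) (F G : I -> R) :
  \rsum_i (if P i then F i else G i) =
  \big[Rplus/0]_(i | P i) F i + \big[Rplus/0]_(i | ~~ P i) G i.
Proof.
rewrite (bigID P) /=; congr (_ + _); apply: eq_bigr => i; first by move->.
by move/negbTE->.
Qed.

Lemma Rsum_delta (I : finType) (F : I -> R) (k : I) :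
  \rsum_i (if i == k then F i else 0) = F k.
Proof. by rewrite Rsum_if big_pred1_eq big1 //= Rplus_0_r. Qed.

Lemma Rsum_deltar (I : finType) (F : I -> R) (k : I) :
  \rsum_i (if k == i then F i else 0) = F k.
Proof. by under eq_bigr do rewrite eq_sym; rewrite Rsum_delta. Qed.

Lemma Rsum2_sym n (f : 'I_n -> 'I_n -> R) :
  (forall i j, f i j = f j i) -> (forall i, f i i = 0) ->
  \rsum_i \rsum_j f i j = 2 * \big[Rplus/0]_(i : 'I_n) \big[Rplus/0]_(j : 'I_n | ltn i j) f i j.
Proof.
move=> fs f0.
have split3 i : \rsum_j f i j =
    \big[Rplus/0]_(j : 'I_n | ltn i j) f i j + \big[Rplus/0]_(j : 'I_n | ltn j i) f i j.
  rewrite (bigID (fun j : 'I_n => ltn i j)) /=; congr (_ + _).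
  rewrite (bigID (fun j => j == i)) /= big1; last by move=> j /andP [_ /eqP ->].
  rewrite Rplus_0_l; apply: eq_bigl => j.
  by rewrite -leqNgt [in RHS]ltn_neqAle andbC.
under eq_bigr => i _ do rewrite split3.
rewrite big_split /= (exchange_big_dep xpredT) //=.
under [X in _ + X]eq_bigr => i _ do under eq_bigr => j _ do rewrite fs.
lra.
Qed.

Lemma Rprod_exp (I : finType) (P : pred I) (F : I -> R) :
  \big[Rmult/1]_(i | P i) exp (F i) = exp (\big[Rplus/0]_(i | P i) F i).
Proof.
elim/big_rec2: _ => [|i x y _ ->]; first by rewrite exp_0.
by rewrite exp_plus.
Qed.

Lemma Rprod_ge0 (I : finType) (P : pred I) (F : I -> R) :
  (forall i, P i -> 0 <= F i) -> 0 <= \big[Rmult/1]_(i | P i) F i.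
Proof. by move=> F0; elim/big_ind: _ => //; [lra | move=> x y; nra]. Qed.

Lemma Rprod_le (I : finType) (P : pred I) (F G : I -> R) :
  (forall i, P i -> 0 <= F i <= G i) ->
  \big[Rmult/1]_(i | P i) F i <= \big[Rmult/1]_(i | P i) G i.
Proof.
move=> h; suff : 0 <= \big[Rmult/1]_(i | P i) F i <= \big[Rmult/1]_(i | P i) G i by lra.
elim/big_rec2: _ => [|i x y Pi IH]; first lra.
have := h _ Pi; nra.
Qed.

(** * Random graphs and Chernoff bounds *)

Definition upper_part n (A : graph n) : graph n :=
  [ffun p : 'I_n * 'I_n => ltn p.1 p.2 && A p].

Definition symmetrize n (B : graph n) : graph n :=
  [ffun p : 'I_n * 'I_n => [|| ltn p.1 p.2 && B p | ltn p.2 p.1 && B (p.2, p.1)]].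

Lemma adj_validP n (A : graph n) :
  reflect ((forall i, A (i, i) = false) /\ forall i j, A (i, j) = A (j, i)) (adj_valid A).
Proof.
apply: (iffP andP) => [[/forallP h1 /forallP h2]|[h1 h2]]; split.
- by move=> i; apply/negbTE/h1.
- by move=> i j; apply/eqP; move/forallP: (h2 i).
- by apply/forallP => i; rewrite h1.
- by apply/forallP => i; apply/forallP => j; rewrite h2.
Qed.

Lemma symmetrize_valid n (B : graph n) : adj_valid (symmetrize B).
Proof.
apply/adj_validP; split => [i|i j]; first by rewrite ffunE /= ltnn.
by rewrite !ffunE /= orbC.
Qed.

Lemma upper_partK n (A : graph n) : adj_valid A -> symmetrize (upper_part A) = A.
Proof.
move=> /adj_validP [A0 As]; apply/ffunP => -[i j]; rewrite !ffunE /=.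
case: (ltngtP i j) => [h|h|h] /=; rewrite ?orbF //.
by rewrite (_ : i = j) ?A0 //; apply: val_inj.
Qed.

Lemma symmetrizeK n (B : graph n) :
  (upper_part (symmetrize B) == B) = [forall p, B p ==> ltn p.1 p.2].
Proof.
apply/eqP/forallP => [<- p|h]; first by rewrite ffunE; apply/implyP => /andP [].
apply/ffunP => -[i j]; rewrite !ffunE /=; have := h (i, j); rewrite /=.
by case: (ltngtP i j) => //= _; case: (B (i, j)).
Qed.

(* A valid graph is determined by its upper triangle, which is an arbitrary boolean function. *)
Lemma sum_graph_prod n (g : 'I_n -> 'I_n -> bool -> R) :
  \big[Rplus/0]_(A : graph n)
     (if adj_valid A
      then \big[Rmult/1]_(i : 'I_n) \big[Rmult/1]_(j : 'I_n | ltn i j) g i j (A (i, j)) else 0) =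
  \big[Rmult/1]_(i : 'I_n) \big[Rmult/1]_(j : 'I_n | ltn i j) (g i j true + g i j false).
Proof.
rewrite Rsum_if [X in _ + X]big1 // Rplus_0_r.
rewrite (reindex_onto (@symmetrize n) (@upper_part n)); last first.
  by move=> A; apply: upper_partK.
under eq_bigl => B do rewrite symmetrize_valid symmetrizeK /=.
(* Off the upper triangle [true] weighs 0 and [false] weighs 1, so the expanded product over all
   pairs keeps exactly the functions supported above the diagonal. *)
pose F (p : 'I_n * 'I_n) b := if ltn p.1 p.2 then g p.1 p.2 b else if b then 0 else 1.
transitivity (\big[Rmult/1]_p \big[Rplus/0]_b F p b); last first.
  rewrite pair_big_dep /= [RHS]big_mkcond /=; apply: eq_bigr => p _.
  by rewrite big_bool /F /=; case: ifP => _; lra.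
rewrite bigA_distr_bigA /= [RHS](bigID (fun B : graph n => [forall p, B p ==> ltn p.1 p.2])) /=.
rewrite [X in _ = _ + X]big1 ?Rplus_0_r; last first.
  move=> B /forallPn [p]; rewrite negb_imply => /andP [Bp /negbTE hp].
  by rewrite (bigD1 p) //= /F /= hp Bp Rmult_0_l.
apply: eq_bigr => B /forallP hB.
rewrite pair_big_dep /= big_mkcond /=; apply: eq_bigr => -[i j] _; rewrite /F /=.
have := hB (i, j); rewrite /= ffunE /=; case: (ltngtP i j) => //= _; rewrite ?orbF //.
all: by case: (B (i, j)).
Qed.

Section Probability.

Variables (n : nat) (a b : R) (sigma : 'I_n -> bool).

Local Notation p_ := (edge_prob a b sigma).
Local Notation mass := (sbm_mass a b sigma).
Local Notation Pr := (sbm_prob a b sigma).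

Lemma sbm_mass_sum : \big[Rplus/0]_(A : graph n) mass A = 1.
Proof.
have := sum_graph_prod (fun i j b0 => if b0 then p_ i j else 1 - p_ i j).
rewrite /sbm_mass => ->; rewrite big1 // => i _; rewrite big1 // => j _; lra.
Qed.

Lemma edge_prob_sym i j : p_ i j = p_ j i.
Proof. by rewrite /edge_prob eq_sym. Qed.

Hypothesis p01 : forall i j, 0 <= p_ i j <= 1.

Lemma sbm_mass_ge0 A : 0 <= mass A.
Proof.
rewrite /sbm_mass; case: ifP => _; last lra.
apply: Rprod_ge0 => i _; apply: Rprod_ge0 => j _; case: ifP => _; have := p01 i j; lra.
Qed.

Lemma sbm_prob_mono (E F : graph n -> Prop) :
  (forall A, adj_valid A -> E A -> F A) -> Pr E <= Pr F.
Proof.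
move=> EF; apply: Rsum_le => A _.
have h0 := sbm_mass_ge0 A.
case: excluded_middle_informative => hE; case: excluded_middle_informative => hF /=; try lra.
rewrite /sbm_mass; case: ifP => hA; last lra.
by case: hF; apply: EF.
Qed.

Lemma sbm_probC (E : graph n -> Prop) : Pr E = 1 - Pr (fun A => ~ E A).
Proof.
suff : Pr E + Pr (fun A => ~ E A) = 1 by lra.
rewrite /sbm_prob -big_split /= -[RHS]sbm_mass_sum; apply: eq_bigr => A _.
case: excluded_middle_informative => hE; case: excluded_middle_informative => hF /=; try lra; tauto.
Qed.

Lemma sbm_prob_or (E F : graph n -> Prop) : Pr (fun A => E A \/ F A) <= Pr E + Pr F.
Proof.
rewrite /sbm_prob -big_split /=; apply: Rsum_le => A _; have h0 := sbm_mass_ge0 A.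
do 3 (case: excluded_middle_informative => ? /=); try lra; tauto.
Qed.

Lemma sbm_prob_exists (I : finType) (P : pred I) (E : I -> graph n -> Prop) :
  Pr (fun A => exists2 k, P k & E k A) <= \big[Rplus/0]_(k | P k) Pr (E k).
Proof.
rewrite /sbm_prob exchange_big /=; apply: Rsum_le => A _; have h0 := sbm_mass_ge0 A.
set s := \big[_/_]_(_ | _) _.
have s0 : 0 <= s by apply: Rsum_ge0 => k _; case: excluded_middle_informative => ? /=; lra.
case: excluded_middle_informative => [[k Pk Ek]|_] //=.
rewrite /s (bigD1 k) //=; case: excluded_middle_informative => //= _.
set t := \big[_/_]_(_ | _) _.
suff : 0 <= t by lra.
by apply: Rsum_ge0 => i _; case: excluded_middle_informative => ? /=; lra.
Qed.

(** Exponential Markov inequality, with the Bernoulli moment generating function [1 + p (exp c - 1)]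
    bounded by [exp (p (exp c - 1))]. The tilt is absorbed into the weights [c], so one bound serves
    rows, vertex subsets and sign vectors. *)
Lemma sbm_chernoff_upper (c : 'I_n -> 'I_n -> R) (t : R) :
  Pr (fun A => t <= \big[Rplus/0]_(i : 'I_n) \big[Rplus/0]_(j : 'I_n | ltn i j) (c i j * adjR A i j))
  <= exp (- t + \big[Rplus/0]_(i : 'I_n)
                \big[Rplus/0]_(j : 'I_n | ltn i j) (p_ i j * (exp (c i j) - 1))).
Proof.
set X := fun A : graph n =>
  \big[Rplus/0]_(i : 'I_n) \big[Rplus/0]_(j : 'I_n | ltn i j) (c i j * adjR A i j).
apply: (Rle_trans _ (\big[Rplus/0]_A (exp (- t) * (mass A * exp (X A))))).
  apply: Rsum_le => A _; have h0 := sbm_mass_ge0 A.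
  case: excluded_middle_informative => h /=; last first.
    have := exp_pos (- t); have := exp_pos (X A) => h1 h2.
    by apply: Rmult_le_pos; [lra | apply: Rmult_le_pos => //; lra].
  have e1 : 1 <= exp (- t) * exp (X A).
    rewrite -exp_plus -exp_0; have : 0 <= - t + X A by rewrite /X; lra.
    by case=> [/exp_increasing|->]; lra.
  nra.
rewrite Rsum_mull exp_plus; apply: Rmult_le_compat_l; first by have := exp_pos (- t); lra.
pose g i j (b0 : bool) := (if b0 then p_ i j else 1 - p_ i j) * exp (c i j * (if b0 then 1 else 0)).
have -> : \rsum_A (mass A * exp (X A)) = \big[Rplus/0]_(A : graph n)
     (if adj_valid A
      then \big[Rmult/1]_(i : 'I_n) \big[Rmult/1]_(j : 'I_n | ltn i j) g i j (A (i, j)) else 0).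
  apply: eq_bigr => A _; rewrite /sbm_mass; case: ifP => _; last lra.
  rewrite /X -Rprod_exp -big_split /=; apply: eq_bigr => i _.
  by rewrite -Rprod_exp -big_split /=.
rewrite sum_graph_prod -Rprod_exp; apply: Rprod_le => i _.
rewrite -Rprod_exp.
have g0 j : 0 <= g i j true + g i j false.
  have := p01 i j; rewrite /g; have := exp_pos (c i j * 1); have := exp_pos (c i j * 0); nra.
split; first by apply: Rprod_ge0.
apply: Rprod_le => j _; split => //.
have -> : g i j true + g i j false = 1 + p_ i j * (exp (c i j) - 1).
  by rewrite /g Rmult_1_r Rmult_0_r exp_0; lra.
have := exp_ineq1_le (p_ i j * (exp (c i j) - 1)); lra.
Qed.

Lemma sbm_chernoff (c : 'I_n -> 'I_n -> R) (t : R) :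
  (forall i j, c i j = c j i) -> (forall i, c i i = 0) ->
  Pr (fun A => t <= \rsum_i \rsum_j (c i j * adjR A i j))
  <= exp (- (t / 2) + (\rsum_i \rsum_j (p_ i j * (exp (c i j) - 1))) / 2).
Proof.
move=> cs c0.
apply: Rle_trans (_ : exp (- (t / 2) + \big[Rplus/0]_(i : 'I_n)
   \big[Rplus/0]_(j : 'I_n | ltn i j) (p_ i j * (exp (c i j) - 1))) <= _).
  apply: Rle_trans (sbm_chernoff_upper _ _); apply: sbm_prob_mono => A /adj_validP [A0 As].
  rewrite Rsum2_sym; first lra.
    by move=> i j; rewrite cs /adjR As.
  by move=> i; rewrite c0; lra.
apply: Req_le; congr (exp (_ + _)); rewrite [in RHS]Rsum2_sym; first lra.
  by move=> i j; rewrite cs edge_prob_sym.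
by move=> i; rewrite c0 exp_0; lra.
Qed.

Lemma sbm_chernoff_row (v : 'I_n) (c : 'I_n -> R) (t : R) :
  Pr (fun A => t <= \rsum_j (c j * adjR A v j))
  <= exp (- t + \big[Rplus/0]_(j | j != v) (p_ v j * (exp (c j) - 1))).
Proof.
(* Symmetric weights supported on row and column [v]: the double sum is twice the row sum, whence
   the threshold [2 * t] below. *)
pose C i j : R := if i == j then 0 else if i == v then c j else if j == v then c i else 0.
have row f : (forall i j, f i j = f j i) -> (forall i, f i i = 0) ->
    (forall i j, i != v -> j != v -> f i j = 0) ->
    \rsum_i \rsum_j f i j = 2 * \big[Rplus/0]_(j | j != v) f v j.
  move=> fs f0 fv; rewrite (bigD1 v) //= (bigD1 v) //= f0.
  have -> : \big[Rplus/0]_(i | i != v) \rsum_j f i j = \big[Rplus/0]_(i | i != v) f v i.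
    apply: eq_bigr => i iv; rewrite (bigD1 v) //= big1 ?Rplus_0_r //.
    by move=> j jv; apply: fv.
  by rewrite /= Rplus_0_l; set s := \big[_/_]_(_ | _) _; lra.
have CE j : j != v -> C v j = c j by move=> jv; rewrite /C eq_sym (negbTE jv) eqxx.
have Cs i j : C i j = C j i.
  rewrite /C (eq_sym j i); case: eqP => // ij; case: eqP => // iv; case: eqP => // jv.
  by case: ij; rewrite iv jv.
have C0 i : C i i = 0 by rewrite /C eqxx.
have Cv i j : i != v -> j != v -> C i j = 0.
  by move=> /negbTE h1 /negbTE h2; rewrite /C h1 h2; case: ifP.
have := @sbm_chernoff C (2 * t) Cs C0.
rewrite row; last 3 first.
- by move=> i j; rewrite Cs edge_prob_sym.
- by move=> i; rewrite C0 exp_0; lra.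
- by move=> i j h1 h2; rewrite Cv // exp_0; lra.
move=> h; apply: Rle_trans (Rle_trans _ _ _ _ h) _.
  apply: sbm_prob_mono => A /adj_validP [A0 As] ht.
  rewrite row; last 3 first.
  - by move=> i j; rewrite Cs /adjR As.
  - by move=> i; rewrite C0; lra.
  - by move=> i j h1 h2; rewrite Cv //; lra.
  apply: Rmult_le_compat_l; first lra.
  apply: Rle_trans ht _; rewrite (bigD1 v) //= {1}/adjR A0 Rmult_0_r Rplus_0_l.
  by apply: Rsum_le => j jv; rewrite CE //; lra.
apply: Req_le; congr exp.
have -> : 2 * t / 2 = t by lra.
set s1 := \big[_/_]_(_ | _) _; set s2 := \big[_/_]_(_ | _) _.
suff : s1 = s2 by lra.
by apply: eq_bigr => j jv; rewrite CE.
Qed.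

End Probability.

(** * Duality certificate *)

Definition bform n (M : 'I_n -> 'I_n -> R) (x y : 'I_n -> R) : R :=
  \rsum_i \rsum_j (x i * M i j * y j).

Section BilinearForms.

Variables (n : nat) (M : 'I_n -> 'I_n -> R).

Lemma bformDl x x' y : bform M (fun i => x i + x' i) y = bform M x y + bform M x' y.
Proof.
rewrite /bform -big_split /=; apply: eq_bigr => i _.
by rewrite -big_split /=; apply: eq_bigr => j _; lra.
Qed.

Lemma bformZl c x y : bform M (fun i => c * x i) y = c * bform M x y.
Proof.
rewrite /bform -Rsum_mull; apply: eq_bigr => i _.
by rewrite -Rsum_mull; apply: eq_bigr => j _; lra.
Qed.

Lemma bformDr x y y' : bform M x (fun i => y i + y' i) = bform M x y + bform M x y'.
Proof.
rewrite /bform -big_split /=; apply: eq_bigr => i _.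
by rewrite -big_split /=; apply: eq_bigr => j _; lra.
Qed.

Lemma bformZr c x y : bform M x (fun i => c * y i) = c * bform M x y.
Proof.
rewrite /bform -Rsum_mull; apply: eq_bigr => i _.
by rewrite -Rsum_mull; apply: eq_bigr => j _; lra.
Qed.

Lemma bform_ext x x' y y' : x =1 x' -> y =1 y' -> bform M x y = bform M x' y'.
Proof.
by move=> hx hy; apply: eq_bigr => i _; apply: eq_bigr => j _; rewrite hx hy.
Qed.

Hypothesis Msym : forall i j, M i j = M j i.

Lemma bformC x y : bform M x y = bform M y x.
Proof.
rewrite /bform exchange_big /=; apply: eq_bigr => i _; apply: eq_bigr => j _.
by rewrite Msym; lra.
Qed.

Lemma bform_sqD c x y :
  bform M (fun i => x i + c * y i) (fun i => x i + c * y i) =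
  bform M x x + 2 * c * bform M x y + c ^ 2 * bform M y y.
Proof.
rewrite bformDl !bformDr !bformZl !bformZr (bformC y x); lra.
Qed.

(** Polarization followed by the parallelogram law. The sum of squares on the right avoids square
    roots; the caller balances the two norms by rescaling. *)
Lemma bform_bound e :
  (forall x, Rabs (bform M x x) <= e * \rsum_i (x i) ^ 2) ->
  forall x y, 2 * Rabs (bform M x y) <= e * (\rsum_i (x i) ^ 2 + \rsum_i (y i) ^ 2).
Proof.
move=> hM x y.
have h1 := bform_sqD 1 x y; have h2 := bform_sqD (-1) x y.
have := hM (fun i => x i + 1 * y i); have := hM (fun i => x i + -1 * y i).
rewrite h1 h2.
have -> : \rsum_i (x i + 1 * y i) ^ 2 =
   \rsum_i (x i) ^ 2 + 2 * \rsum_i (x i * y i) + \rsum_i (y i) ^ 2.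
  by rewrite -Rsum_mull -!big_split /=; apply: eq_bigr => i _; lra.
have -> : \rsum_i (x i + -1 * y i) ^ 2 =
   \rsum_i (x i) ^ 2 - 2 * \rsum_i (x i * y i) + \rsum_i (y i) ^ 2.
  by rewrite -Rsum_mull -Rsum_sub -!big_split /=; apply: eq_bigr => i _; lra.
set X := \rsum_i (x i) ^ 2; set Y := \rsum_i (y i) ^ 2; set Z := \rsum_i (x i * y i).
move: (bform M x x) (bform M x y) (bform M y y) => u v w.
by split_Rabs; lra.
Qed.

End BilinearForms.

(** * Positive semidefinite matrices and Gram decompositions *)

Definition delta_vec n (k i : 'I_n) : R := if i == k then 1 else 0.

Lemma Rsum_delta_vec n (k : 'I_n) (f : 'I_n -> R) : \rsum_i (delta_vec k i * f i) = f k.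
Proof.
rewrite -[RHS](Rsum_delta f k); apply: eq_bigr => i _; rewrite /delta_vec.
by case: ifP => _; lra.
Qed.

Lemma bform_deltar n M (x : 'I_n -> R) k : bform M x (delta_vec k) = \rsum_i (x i * M i k).
Proof.
apply: eq_bigr => i _; rewrite -[RHS](Rsum_delta_vec k (fun j => x i * M i j)).
by apply: eq_bigr => j _; lra.
Qed.

Lemma bform_delta n M (k l : 'I_n) : bform M (delta_vec k) (delta_vec l) = M k l.
Proof. by rewrite bform_deltar Rsum_delta_vec. Qed.

Lemma psd_pair n (Y : 'I_n -> 'I_n -> R) i j t :
  psd Y -> 0 <= Y i i + 2 * t * Y i j + t ^ 2 * Y j j.
Proof.
move=> [Ys Yp]; have := Yp (fun k => delta_vec i k + t * delta_vec j k).
by rewrite -/(bform _ _ _) bform_sqD // !bform_delta.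
Qed.

Lemma psd_diag_ge0 n (Y : 'I_n -> 'I_n -> R) i : psd Y -> 0 <= Y i i.
Proof. by move=> /(psd_pair i i 0); lra. Qed.

Lemma psd_diag0 n (Y : 'I_n -> 'I_n -> R) i j : psd Y -> Y i i = 0 -> Y i j = 0.
Proof.
move=> hY Yii; have h0 := psd_diag_ge0 j hY.
case: (Req_dec (Y i j) 0) => // Yij.
have [Ys _] := hY.
(* Since [Y i i = 0], the bound of [psd_pair] is affine in [t]; this [t] brings it down to -1. *)
have := psd_pair j i (- (Y j j + 1) / (2 * Y i j)) hY; rewrite Yii (Ys j i).
have -> : 2 * (- (Y j j + 1) / (2 * Y i j)) * Y i j = - (Y j j + 1) by field.
lra.
Qed.

(* Iterated Schur complements: pivoting on [k] removes the rank-one matrix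
   [Y_ik Y_kj / Y_kk] and leaves a positive semidefinite matrix vanishing at [k]. *)
Lemma psd_gram n (Y : 'I_n -> 'I_n -> R) :
  psd Y -> exists vs : seq ('I_n -> R),
    forall i j, Y i j = \big[Rplus/0]_(v <- vs) (v i * v j).
Proof.
(* Induction on a list of indices outside which the diagonal vanishes; by [psd_diag0] the rows
   outside the list then vanish too. *)
move=> hY; have : forall i, i \notin enum 'I_n -> Y i i = 0 by move=> i; rewrite mem_enum.
elim: (enum 'I_n) Y hY => [|k l IH] Y hY Y0.
  by exists [::] => i j; rewrite big_nil; apply: psd_diag0 => //; apply: Y0.
case: (Req_dec (Y k k) 0) => [Ykk|Ykk].
  apply: IH => // i il; case: (eqVneq i k) => [-> //|ik]; apply: Y0.
  by rewrite inE negb_or ik.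
have Ykk_gt0 : 0 < Y k k by have := psd_diag_ge0 k hY; lra.
have [Ys Yp] := hY.
pose v i := Y i k / sqrt (Y k k).
have vv i j : v i * v j = Y i k * Y j k / Y k k.
  rewrite /v -[in RHS](sqrt_sqrt (Y k k)); last lra.
  by field; apply: Rgt_not_eq; apply: sqrt_lt_R0.
pose Y' i j := Y i j - v i * v j.
have hY' : psd Y'.
  split => [i j|x]; first by rewrite /Y' Ys; lra.
  pose s := \rsum_i (x i * Y i k).
  have -> : \rsum_i \rsum_j (x i * Y' i j * x j) = bform Y x x - s ^ 2 / Y k k.
    have -> : s ^ 2 / Y k k = \rsum_i \rsum_j (x i * (v i * v j) * x j).
      under eq_bigr => i _ do under eq_bigr => j _ do rewrite vv.
      transitivity (\rsum_i (x i * Y i k * (s / Y k k))); first by rewrite Rsum_mulr -/s; field.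
      apply: eq_bigr => i _.
      transitivity (\rsum_j ((x i * Y i k / Y k k) * (x j * Y j k))).
        by rewrite Rsum_mull -/s; field.
      by apply: eq_bigr => j _; field.
    rewrite -Rsum_sub; apply: eq_bigr => i _; rewrite -Rsum_sub; apply: eq_bigr => j _.
    by rewrite /Y'; lra.
  (* This shift minimizes the form along coordinate [k], and the minimum is the form of the Schur
     complement. *)
  have := Yp (fun i => x i + (- s / Y k k) * delta_vec k i).
  rewrite -/(bform _ _ _) bform_sqD // bform_delta bform_deltar -/s.
  have : 2 * (- s / Y k k) * s + (- s / Y k k) ^ 2 * Y k k = - (s ^ 2 / Y k k) by field.
  lra.
have [vs hvs] : exists vs : seq ('I_n -> R),
    forall i j, Y' i j = \big[Rplus/0]_(v <- vs) (v i * v j).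
  apply: IH => // i il; rewrite /Y' vv; case: (eqVneq i k) => [->|ik].
    by field.
  have Yii : Y i i = 0 by apply: Y0; rewrite inE negb_or ik.
  by rewrite Yii (psd_diag0 k hY Yii); lra.
exists (v :: vs) => i j; rewrite big_cons -hvs /Y'; lra.
Qed.

(** * Optimality of the planted matrix *)

Lemma sgn_sq b : sgn b * sgn b = 1.
Proof. by case: b; rewrite /sgn; lra. Qed.

Lemma outer_diag n (sigma : 'I_n -> bool) i : outer sigma i i = 1.
Proof. exact: sgn_sq. Qed.

Lemma sum_sgn n (sigma : 'I_n -> bool) :
  \rsum_i sgn (sigma i) = 2 * INR #|[set i | sigma i]| - INR n.
Proof.
rewrite /sgn Rsum_if !Rsum_const.
set k := #|_|; set m := #|(fun _ => ~~ _)|.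
have -> : #|[set i | sigma i]| = k by apply: eq_card => i; rewrite !inE.
have -> : INR n = INR k + INR m.
  rewrite -plus_INR; congr INR; rewrite -[LHS]card_ord -(cardID sigma).
  by congr addn; apply: eq_card => i; rewrite !inE ?andbT.
lra.
Qed.

Lemma outer_feasible n K (sigma : 'I_n -> bool) :
  #|[set i | sigma i]| = K -> sdp_feasible K (outer sigma).
Proof.
move=> hK; split; [split|split].
- by move=> i j; rewrite /outer; lra.
- move=> x.
  have -> : \rsum_i \rsum_j (x i * outer sigma i j * x j) =
            (\rsum_i (x i * sgn (sigma i))) * (\rsum_i (x i * sgn (sigma i))).
    rewrite -Rsum_mulr; apply: eq_bigr => i _; rewrite -Rsum_mull.
    by apply: eq_bigr => j _; rewrite /outer; lra.
  by nra.
- exact: outer_diag.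
- rewrite -hK -sum_sgn /= Rmult_1_r -Rsum_mulr; apply: eq_bigr => i _.
  by rewrite -Rsum_mull.
Qed.

Definition dual_slack n (A : graph n) (D : 'I_n -> R) (lam : R) (i j : 'I_n) : R :=
  (if i == j then D i else 0) - adjR A i j + lam.

(* On the feasible set [<A, Y> = tr D + lam (2K - n)^2 - <S, Y>], and [<S, Y>] is a sum
   of values [v^T S v] along a Gram decomposition of [Y]. *)
Lemma sdp_certificate n K (A : graph n) (sigma : 'I_n -> bool) D lam :
  adj_valid A -> #|[set i | sigma i]| = K ->
  (forall i, \rsum_j (dual_slack A D lam i j * sgn (sigma j)) = 0) ->
  (forall x, \rsum_i (x i * sgn (sigma i)) = 0 -> (exists i, x i <> 0) ->
     0 < bform (dual_slack A D lam) x x) ->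
  sdp_unique_opt K A (outer sigma).
Proof.
move=> /adj_validP [A0 As] hK; set S := dual_slack A D lam => Ssig Spos.
pose s i := sgn (sigma i).
have Ssym i j : S i j = S j i.
  by rewrite /S /dual_slack /adjR As eq_sym; case: eqP => [->|].
split; first exact: outer_feasible.
move=> Y hY [i0 [j0 neqY]].
have n_gt0 : 0 < INR n by apply: lt_0_INR; apply/ltP; apply: leq_ltn_trans (ltn_ord i0).
have Sker c x : (forall i, x i = c * s i) -> forall y, bform S y x = 0.
  move=> hx y; rewrite /bform big1 // => i _.
  transitivity (\rsum_j ((c * y i) * (S i j * s j))).
    by apply: eq_bigr => j _; rewrite hx; lra.
  by rewrite Rsum_mull Ssig; lra.
(* Removing the component along [s] leaves the form unchanged, so [S] is positive semidefinite and
   its form vanishes only on multiples of [s]. *)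
have Sform x : 0 <= bform S x x /\ (bform S x x <= 0 -> exists c, forall i, x i = c * s i).
  pose c := (\rsum_i (x i * s i)) / INR n.
  pose y i := x i + - c * s i.
  have ys : \rsum_i (y i * sgn (sigma i)) = 0.
    have -> : \rsum_i (y i * sgn (sigma i)) = \rsum_i (x i * s i - c).
      apply: eq_bigr => i _; transitivity (x i * s i - c * (s i * s i)); first by rewrite /y /s; ring.
      by rewrite sgn_sq; ring.
    by rewrite Rsum_sub Rsum_const_ord /c; field; lra.
  have -> : bform S x x = bform S y y.
    rewrite bform_sqD // (Sker 1 s) => [|i]; last lra.
    by rewrite (Sker 1 s) => [|i]; lra.
  case: (excluded_middle_informative (exists i, y i <> 0)) => hy.
    by have := Spos y ys hy; split; lra.
  have y0 i : y i = 0.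
    by case: (Req_dec (y i) 0) => // yi; case: hy; exists i.
  split; last by move=> _; exists c => i; have := y0 i; rewrite /y; lra.
  by rewrite /bform big1; [lra | move=> i _; rewrite big1 // => j _; rewrite y0; lra].
pose ip (Z : 'I_n -> 'I_n -> R) := \rsum_i \rsum_j (S i j * Z i j).
have ip_obj Z : sdp_feasible K Z ->
    ip Z = \rsum_i D i - sdp_obj A Z + lam * (2 * INR K - INR n) ^ 2.
  move=> [_ [Zd <-]]; rewrite /ip /sdp_obj -Rsum_mull -Rsum_sub -big_split /=.
  apply: eq_bigr => i _; rewrite -(Rsum_deltar (fun=> D i) i) -Rsum_mull -Rsum_sub -big_split /=.
  apply: eq_bigr => j _; rewrite /S /dual_slack; case: eqP => [<-|_]; last lra.
  by rewrite Zd; lra.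
have ip_outer : ip (outer sigma) = 0.
  rewrite /ip big1 // => i _.
  transitivity (\rsum_j (s i * (S i j * s j))).
    by apply: eq_bigr => j _; rewrite /outer /s; lra.
  by rewrite Rsum_mull Ssig; lra.
have [vs hvs] := psd_gram (proj1 hY).
have ip_gram us : \rsum_i \rsum_j (S i j * \big[Rplus/0]_(v <- us) (v i * v j)) =
    \big[Rplus/0]_(v <- us) bform S v v.
  rewrite /bform [RHS]exchange_big /=; apply: eq_bigr => i _.
  rewrite [RHS]exchange_big /=; apply: eq_bigr => j _.
  by rewrite big_distrr /=; apply: eq_bigr => v _; lra.
have gram_ge0 us : 0 <= \big[Rplus/0]_(v <- us) bform S v v.
  by elim/big_rec: _ => [|v x _ ?]; [lra | have := proj1 (Sform v); lra].
(* Equality in weak duality forces every Gram vector of [Y] onto the line of [s]; the unit diagonal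
   then fixes the factor. *)
have gram0 us : \big[Rplus/0]_(v <- us) bform S v v <= 0 ->
    exists c, forall i j, \big[Rplus/0]_(v <- us) (v i * v j) = c * outer sigma i j.
  elim: us => [|v us IH]; first by move=> _; exists 0 => i j; rewrite big_nil; lra.
  rewrite big_cons => h; have h1 := gram_ge0 us; have [h2 h3] := Sform v.
  have [|c hc] := IH; first lra.
  have [|d hd] := h3; first lra.
  by exists (d ^ 2 + c) => i j; rewrite big_cons hc !hd /outer /s; lra.
have hO := outer_feasible hK.
apply: Rnot_le_lt => hle; apply: neqY.
have [|c hc] := gram0 vs.
  rewrite -ip_gram.
  have -> : \rsum_i \rsum_j (S i j * \big[Rplus/0]_(v <- vs) (v i * v j)) = ip Y.
    by apply: eq_bigr => i _; apply: eq_bigr => j _; rewrite hvs.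
  by have := ip_obj _ hY; have := ip_obj _ hO; rewrite ip_outer; lra.
have [_ [Yd _]] := hY.
have c1 : c = 1 by have := Yd i0; rewrite hvs hc outer_diag; lra.
by rewrite hvs hc c1; lra.
Qed.

(** Entries of a positive semidefinite matrix with unit diagonal are at most 1, and here they must
    sum to [n ^ 2]: the all-ones matrix is the only feasible point, whatever the graph. *)
Lemma sdp_unique_opt_extreme n (A : graph n) (sigma : 'I_n -> bool) :
  #|[set i | sigma i]| = O -> sdp_unique_opt O A (outer sigma).
Proof.
move=> h0; split; first exact: outer_feasible.
move=> Y [hY [Yd Ysum]] [i [j neqY]]; exfalso.
have sF k : sigma k = false.
  by move/cards0_eq/setP: h0 => /(_ k); rewrite !inE.
have Y1 k l : 0 <= 1 - Y k l by have := psd_pair k l (-1) hY; rewrite !Yd; lra.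
have : \rsum_k \rsum_l (1 - Y k l) = 0.
  under eq_bigr => k _ do rewrite Rsum_sub Rsum_const_ord.
  by rewrite Rsum_sub Rsum_const_ord Ysum /=; ring.
have h1 : 1 - Y i j <= \rsum_k \rsum_l (1 - Y k l).
  apply: Rle_trans (Rsum_term_le (F := fun l => 1 - Y i l) j _) _ => //.
  by apply: (Rsum_term_le (F := fun k => \rsum_l (1 - Y k l)) i) => k; apply: Rsum_ge0.
move=> h2; apply: neqY; rewrite /outer !sF /sgn; have := Y1 i j; lra.
Qed.

(** * Positivity of the dual slack matrix *)

Definition mean_mx n (p q : R) (sigma : 'I_n -> bool) (i j : 'I_n) : R :=
  if i == j then 0 else if sigma i == sigma j then p else q.

Definition noise n (p q : R) (sigma : 'I_n -> bool) (A : graph n) (i j : 'I_n) : R :=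
  adjR A i j - mean_mx p q sigma i j.

(** Row [i] of [S sigma = 0] solved for the diagonal entry. The first term is the degree of [i] into
    its own cluster minus its degree into the other one. *)
Definition dual_diag n (A : graph n) (sigma : 'I_n -> bool) (lam : R) (i : 'I_n) : R :=
  sgn (sigma i) * \rsum_j (adjR A i j * sgn (sigma j)) - lam * sgn (sigma i) * \rsum_j sgn (sigma j).

Lemma noise_sym n p q (sigma : 'I_n -> bool) A i j :
  adj_valid A -> noise p q sigma A i j = noise p q sigma A j i.
Proof.
by move=> /adj_validP [_ As]; rewrite /noise /mean_mx /adjR As eq_sym (eq_sym (sigma i)).
Qed.

Lemma dual_slack_ker n A (sigma : 'I_n -> bool) lam i :
  \rsum_j (dual_slack A (dual_diag A sigma lam) lam i j * sgn (sigma j)) = 0.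
Proof.
set D := dual_diag A sigma lam.
have -> : \rsum_j (dual_slack A D lam i j * sgn (sigma j)) =
  \rsum_j (if i == j then D j * sgn (sigma j) else 0)
  - \rsum_j (adjR A i j * sgn (sigma j)) + lam * \rsum_j sgn (sigma j).
  rewrite -Rsum_mull -Rsum_sub -big_split /=; apply: eq_bigr => j _.
  by rewrite /dual_slack; case: eqP => [<-|_]; lra.
rewrite Rsum_deltar /D /dual_diag.
set X := \rsum_j (adjR A i j * _); set Y := \rsum_j sgn _.
transitivity ((sgn (sigma i) * sgn (sigma i) - 1) * (X - lam * Y)); first ring.
by rewrite sgn_sq; ring.
Qed.

Lemma sum_affine_sgn n (sigma : 'I_n -> bool) (u v : R) :
  \rsum_i (if sigma i then u else v) =
  INR #|[set i | sigma i]| * u + (INR n - INR #|[set i | sigma i]|) * v.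
Proof.
have h := sum_sgn sigma; set k := INR _ in h *.
have -> : \rsum_i (if sigma i then u else v) = \rsum_i ((u + v) / 2 + (u - v) / 2 * sgn (sigma i)).
  by apply: eq_bigr => i _; rewrite /sgn; case: (sigma i); field.
rewrite big_split /= Rsum_const_ord Rsum_mull h; field.
Qed.

Section SlackPositive.

Variables (n : nat) (p q lam e d0 r k : R) (sigma : 'I_n -> bool) (A : graph n).

Local Notation m := (INR n - k).
Local Notation s i := (sgn (sigma i)).
Local Notation W := (noise p q sigma A).
Local Notation D := (dual_diag A sigma lam).

Hypothesis Avalid : adj_valid A.
Hypothesis kE : INR #|[set i | sigma i]| = k.
Hypotheses (k_gt0 : 0 < k) (m_gt0 : 0 < m) (rk : INR n <= r * k) (rm : INR n <= r * m).
Hypothesis W_small : forall x, Rabs (bform W x x) <= e * \rsum_i (x i) ^ 2.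
Hypothesis D_large : forall i, d0 <= D i.
Hypothesis e_ge0 : 0 <= e.

(** [mean_mx] is [(p + q) / 2 J + (p - q) / 2 sigma sigma^T - p I], and the middle term vanishes on
    vectors orthogonal to [sigma]. *)
Lemma bform_dual_slack x : \rsum_i (x i * s i) = 0 ->
  bform (dual_slack A D lam) x x =
  \rsum_i (D i * (x i) ^ 2) - bform W x x + p * \rsum_i (x i) ^ 2
  + (lam - (p + q) / 2) * (\rsum_i x i) ^ 2.
Proof.
move=> xs.
have sq (y : 'I_n -> R) : \rsum_i \rsum_j (y i * y j) = (\rsum_i y i) ^ 2.
  rewrite /= Rmult_1_r -Rsum_mulr; apply: eq_bigr => i _; by rewrite Rsum_mull.
have diag (y : 'I_n -> R) : \rsum_i y i = \rsum_i \rsum_j (if i == j then y j else 0).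
  by apply: eq_bigr => i _; rewrite Rsum_deltar.
(* Adding this zero makes the identity hold entry by entry. *)
have e0 : (p - q) / 2 * - (\rsum_i (x i * s i)) ^ 2 = 0 by rewrite xs; ring.
rewrite -[RHS]Rplus_0_r -[X in _ = _ + X]e0.
have -> : \rsum_i (D i * (x i) ^ 2) = \rsum_i \rsum_j (if i == j then D j * (x j) ^ 2 else 0).
  exact: diag.
have -> : \rsum_i (x i) ^ 2 = \rsum_i \rsum_j (if i == j then (x j) ^ 2 else 0) by exact: diag.
rewrite -!sq -Rsum_opp.
rewrite -!Rsum_mull /bform -Rsum_sub -!big_split /=; apply: eq_bigr => i _.
rewrite -Rsum_opp -!Rsum_mull -Rsum_sub -!big_split /=; apply: eq_bigr => j _.
rewrite /dual_slack /noise /mean_mx; case: (eqVneq i j) => [<-|_].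
  by have h := sgn_sq (sigma i); transitivity (x i * (D i - adjR A i i + lam) * x i
       + (p - q) / 2 * (1 - s i * s i) * (x i * x i)); [rewrite h|]; field.
by rewrite /sgn; case: (sigma i); case: (sigma j) => /=; field.
Qed.

Lemma dual_diagE i : D i = ((p - q) / 2 * INR n - p)
  + ((p + q) / 2 - lam) * (2 * k - INR n) * s i + s i * \rsum_j (W i j * s j).
Proof.
rewrite /dual_diag -kE -sum_sgn.
have -> : \rsum_j (W i j * s j) = \rsum_j (adjR A i j * s j)
    - ((p - q) / 2 * INR n * s i + (p + q) / 2 * \rsum_j s j - p * s i).
  have -> : (p - q) / 2 * INR n * s i = \big[Rplus/0]_(j : 'I_n) ((p - q) / 2 * s i).
    by rewrite Rsum_const_ord; ring.
  rewrite -(Rsum_deltar (fun j => p * s j) i) -Rsum_mull -big_split /= -!Rsum_sub.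
  apply: eq_bigr => j _; rewrite /noise /mean_mx; case: eqP => [<-|_]; first by field.
  by rewrite /sgn; case: (sigma i); case: (sigma j) => /=; field.
set X := \rsum_j s j; set Y := \rsum_j _.
transitivity (s i * Y - lam * s i * X + (1 - s i * s i) * ((p - q) / 2 * INR n - p)); last by field.
by rewrite sgn_sq; ring.
Qed.

(* Split [x] orthogonal to [sigma] as [u + y] with [u] constant on the clusters and [y] of zero sum
   on each cluster; the expectation of [D] is constant on the clusters, so cross terms only
   involve the noise. *)
Lemma dual_slack_pos x :
  e * (4 * r + 2) < d0 + p -> e * (4 * r + 2) < INR n * (lam - q) ->
  \rsum_i (x i * s i) = 0 -> (exists i, x i <> 0) ->
  0 < bform (dual_slack A D lam) x x.
Proof.
move=> ed eq_ xs [i0 xi0]; rewrite bform_dual_slack //.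
have n_gt0 : 0 < INR n by lra.
(* Orthogonality to [sigma] makes the two cluster sums of [x] equal, so each is [t]; [u] spreads it
   evenly over the cluster. *)
set X := \rsum_i x i; pose t := X / 2.
pose u i := if sigma i then t / k else t / m; pose y i := x i - u i.
have x_sign c d : \rsum_i ((if sigma i then c else d) * x i) = (c + d) * t.
  have -> : \rsum_i ((if sigma i then c else d) * x i) =
      (c + d) / 2 * X + (c - d) / 2 * \rsum_i (x i * s i).
    rewrite -!Rsum_mull -big_split /=; apply: eq_bigr => i _.
    by rewrite /sgn; case: (sigma i); field.
  by rewrite xs /t; field.
have u_sign c d : \rsum_i ((if sigma i then c else d) * u i) = (c + d) * t.
  have -> : \rsum_i ((if sigma i then c else d) * u i) =
      \rsum_i (if sigma i then c * (t / k) else d * (t / m)).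
    by apply: eq_bigr => i _; rewrite /u; case: (sigma i).
  by rewrite sum_affine_sgn kE; field; lra.
have y_sign c d : \rsum_i ((if sigma i then c else d) * y i) = 0.
  have -> : \rsum_i ((if sigma i then c else d) * y i) =
     \rsum_i ((if sigma i then c else d) * x i) - \rsum_i ((if sigma i then c else d) * u i).
    by rewrite -Rsum_sub; apply: eq_bigr => i _; rewrite /y; ring.
  by rewrite x_sign u_sign; ring.
set U2 := \rsum_i (u i) ^ 2; set Y2 := \rsum_i (y i) ^ 2.
have X2E : \rsum_i (x i) ^ 2 = U2 + Y2.
  have <- : U2 + 2 * \rsum_i ((if sigma i then t / k else t / m) * y i) + Y2 = U2 + Y2.
    by rewrite y_sign; ring.
  rewrite -Rsum_mull -!big_split /=; apply: eq_bigr => i _.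
  by rewrite -/(u i) /y; ring.
have U2E : U2 = t ^ 2 * (INR n / (k * m)).
  have -> : U2 = \rsum_i ((if sigma i then t / k else t / m) * u i).
    by apply: eq_bigr => i _; rewrite /u; ring.
  by rewrite u_sign; field; lra.
have X2_gt0 : 0 < U2 + Y2.
  rewrite -X2E; have := @Rsum_term_le _ (fun i => (x i) ^ 2) i0 (fun i => pow2_ge_0 _).
  by case: (Rdichotomy _ _ xi0) => h; nra.
have Y2_ge0 : 0 <= Y2 by apply: Rsum_ge0 => i _; apply: pow2_ge_0.
have U2_ge0 : 0 <= U2 by apply: Rsum_ge0 => i _; apply: pow2_ge_0.
pose al := (p - q) / 2 * INR n - p; pose be := ((p + q) / 2 - lam) * (2 * k - INR n).
(* [x ^ 2 = y ^ 2 + c]: [D_large] is spent on [y ^ 2] only. Against [c], the cluster means of [D]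
   contribute only through [u ^ 2] and its fluctuation is collected in [E]. *)
pose c i := (u i) ^ 2 + 2 * u i * y i.
pose E := \rsum_i (s i * \rsum_j (W i j * s j) * c i).
have DE : \rsum_i (D i * (x i) ^ 2) = \rsum_i (D i * (y i) ^ 2)
     + t ^ 2 * ((al + be) / k + (al - be) / m) + E.
  have -> : t ^ 2 * ((al + be) / k + (al - be) / m) =
      \rsum_i ((if sigma i then (al + be) * (t / k) else (al - be) * (t / m)) * u i)
     + 2 * \rsum_i ((if sigma i then (al + be) * (t / k) else (al - be) * (t / m)) * y i).
    by rewrite y_sign u_sign; field; lra.
  rewrite -Rsum_mull /E -!big_split /=; apply: eq_bigr => i _.
  have -> : x i = u i + y i by rewrite /y; ring.
  rewrite dual_diagE -/al -/be /c; set w := \rsum_j _.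
  by rewrite /u /sgn; case: (sigma i); ring.
have Dy : d0 * Y2 <= \rsum_i (D i * (y i) ^ 2).
  rewrite -Rsum_mull; apply: Rsum_le => i _; apply: Rmult_le_compat_r; first exact: pow2_ge_0.
  exact: D_large.
have u_le i : INR n * (u i) ^ 2 <= r * U2.
  rewrite U2E /u; case: (sigma i).
    have -> : INR n * (t / k) ^ 2 = t ^ 2 * (INR n / (k * m)) * (m / k) by field; lra.
    rewrite (Rmult_comm r); apply: Rmult_le_compat_l; first by rewrite -U2E.
    by apply: (Rmult_le_reg_r k) => //; have -> : m / k * k = m by [field; lra]; lra.
  have -> : INR n * (t / m) ^ 2 = t ^ 2 * (INR n / (k * m)) * (k / m) by field; lra.
  rewrite (Rmult_comm r); apply: Rmult_le_compat_l; first by rewrite -U2E.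
  apply: (Rmult_le_reg_r m) => //; have -> : k / m * m = k by [field; lra].
  by lra.
have r_gt0 : 0 < r by nra.
have E_le : 2 * Rabs E <= e * (8 * r + 1) * (U2 + Y2).
  (* Scale at which [w s] has squared norm [U2 + Y2]. The other argument then has squared norm at
     most [8 r (U2 + Y2)], because [u] is flat by [u_le]. *)
  pose w := sqrt ((U2 + Y2) / INR n).
  have w2 : w ^ 2 = (U2 + Y2) / INR n.
    by rewrite /= Rmult_1_r sqrt_sqrt //; apply: Rlt_le; apply: Rdiv_lt_0_compat.
  have w_gt0 : 0 < w by apply: sqrt_lt_R0; apply: Rdiv_lt_0_compat.
  have -> : E = bform W (fun i => s i * c i / w) (fun i => w * s i).
    apply: eq_bigr => i _; rewrite -Rsum_mull -Rsum_mulr; apply: eq_bigr => j _.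
    by field; lra.
  apply: Rle_trans (bform_bound (fun i j => noise_sym p q sigma i j Avalid) W_small _ _) _.
  rewrite Rmult_assoc; apply: Rmult_le_compat_l => //.
  have -> : \rsum_i (w * s i) ^ 2 = U2 + Y2.
    transitivity (\big[Rplus/0]_(i : 'I_n) ((U2 + Y2) / INR n)).
      by apply: eq_bigr => i _; rewrite -w2 /= -[RHS]Rmult_1_l -(sgn_sq (sigma i)); ring.
    by rewrite Rsum_const_ord; field; lra.
  suff : \rsum_i (s i * c i / w) ^ 2 <= 8 * r * (U2 + Y2) by lra.
  have {1}-> : U2 + Y2 = \rsum_i ((u i) ^ 2 + (y i) ^ 2) by rewrite big_split.
  rewrite -Rsum_mull; apply: Rsum_le => i _.
  have -> : (s i * c i / w) ^ 2 = (c i) ^ 2 * INR n / (U2 + Y2).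
    have -> : (c i) ^ 2 * INR n / (U2 + Y2) = (s i * s i) * (c i) ^ 2 / w ^ 2.
      by rewrite sgn_sq w2; field; lra.
    by field; lra.
  apply: (Rmult_le_reg_r (U2 + Y2)) => //.
  have -> : (c i) ^ 2 * INR n / (U2 + Y2) * (U2 + Y2) = (INR n * (u i) ^ 2) * (u i + 2 * y i) ^ 2.
    by rewrite /c; field; lra.
  have h1 : (INR n * (u i) ^ 2) * (u i + 2 * y i) ^ 2 <= (r * U2) * (u i + 2 * y i) ^ 2.
    by apply: Rmult_le_compat_r (u_le i); apply: pow2_ge_0.
  apply: Rle_trans h1 _.
  have h2 : (u i + 2 * y i) ^ 2 <= 8 * ((u i) ^ 2 + (y i) ^ 2).
    by have := pow2_ge_0 (u i - 2 * y i); have := pow2_ge_0 (u i); nra.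
  apply: Rle_trans (_ : r * U2 * (8 * ((u i) ^ 2 + (y i) ^ 2)) <= _).
    by apply: Rmult_le_compat_l => //; apply: Rmult_le_pos; lra.
  have h3 : 0 <= r * Y2 * ((u i) ^ 2 + (y i) ^ 2).
    apply: Rmult_le_pos; first by apply: Rmult_le_pos; lra.
    by have := pow2_ge_0 (u i); have := pow2_ge_0 (y i); lra.
  by rewrite /= in h3 *; lra.
have W_le := W_small x; rewrite X2E in W_le.
rewrite DE X2E.
have main : t ^ 2 * ((al + be) / k + (al - be) / m) + p * U2 + (lam - (p + q) / 2) * X ^ 2
    = INR n * (lam - q) * U2.
  have -> : X = 2 * t by rewrite /t; field.
  by rewrite U2E /al /be; field; lra.
have hE : - (e * (4 * r + 1 / 2) * (U2 + Y2)) <= E.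
  by move: E_le; rewrite -/E; split_Rabs; lra.
have hW : - (e * (U2 + Y2)) <= - bform W x x by move: W_le; split_Rabs; lra.
(* The noise costs [e (4 r + 1 / 2)] through [E] and [e] through the form at [x]; the constant
   [4 r + 2] covers both. *)
have fin : 0 < (INR n * (lam - q) - e * (4 * r + 2)) * U2 + (d0 + p - e * (4 * r + 2)) * Y2.
  case: U2_ge0 => [U2_gt0|U20]; last by rewrite -U20 Rmult_0_r Rplus_0_l; apply: Rmult_lt_0_compat; lra.
  apply: Rplus_lt_le_0_compat; first by apply: Rmult_lt_0_compat; lra.
  by apply: Rmult_le_pos; lra.
have := Rmult_le_pos _ _ e_ge0 (Rlt_le _ _ X2_gt0).
lra.
Qed.

End SlackPositive.

(** * Spectral bound for the noise *)

Definition indR (c : bool) : R := if c then 1 else 0.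

Definition Rltb (x y : R) : bool := if Rlt_dec x y then true else false.

Lemma RltbP x y : reflect (x < y) (Rltb x y).
Proof. by rewrite /Rltb; case: Rlt_dec => h; constructor. Qed.

(** Ordered pairs: for a valid graph this is twice the number of edges inside [U]. *)
Definition edge_count n (A : graph n) (U : 'I_n -> bool) : R :=
  \rsum_i \rsum_j (indR (U i) * indR (U j) * adjR A i j).

Lemma adjR_ge0 n (A : graph n) i j : 0 <= adjR A i j.
Proof. by rewrite /adjR; case: ifP => _; lra. Qed.

Lemma indR_ge0 c : 0 <= indR c.
Proof. by rewrite /indR; case: c; lra. Qed.

Lemma exists_min (I : eqType) (w : I -> R) (P : pred I) (l : seq I) :
  has P l -> exists2 k, P k & forall i, i \in l -> P i -> w k <= w i.
Proof.
elim: l => [//|i l IH] /=; case: (boolP (has P l)) => [/IH [k Pk hk] _|hl].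
  case: (boolP (P i)) => Pi; last first.
    exists k => // j; rewrite inE => /orP [/eqP ->|]; last exact: hk.
    by rewrite (negbTE Pi).
  case: (Rle_dec (w k) (w i)) => h.
    by exists k => // j; rewrite inE => /orP [/eqP ->|] //; apply: hk.
  exists i => // j; rewrite inE => /orP [/eqP -> _|jl Pj]; first lra.
  by have := hk _ jl Pj; lra.
rewrite orbF => Pi; exists i => // j; rewrite inE => /orP [/eqP -> _|jl Pj]; first lra.
by case/hasP: hl; exists j.
Qed.

(* Layer-cake formula: [Rmin (w i) (w j)] is the measure of the levels [t] for which both
   endpoints lie in [{w > t}]. *)
Lemma layer_cake n (A : graph n) (w : 'I_n -> R) (m : R) :
  (forall i, 0 <= w i) ->
  (forall U : 'I_n -> bool, (forall i, U i -> 0 < w i) ->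
     edge_count A U <= m * \rsum_i indR (U i)) ->
  \rsum_i \rsum_j (adjR A i j * Rmin (w i) (w j)) <= m * \rsum_i w i.
Proof.
move: {2}#|[pred i | Rltb 0 (w i)]| (leqnn #|[pred i | Rltb 0 (w i)]|) => N.
elim: N w => [|N IH] w hN w0 hU.
  have wE i : w i = 0.
    move: hN; rewrite leqn0 => /eqP/card0_eq /(_ i); rewrite !inE => /RltbP.
    have := w0 i; lra.
  rewrite [X in _ * X]big1 // big1; first lra.
  by move=> i _; rewrite big1 // => j _; rewrite !wE Rmin_left; lra.
case: (boolP (has (fun i => Rltb 0 (w i)) (enum 'I_n))) => [hpos|hpos]; last first.
  apply: IH => //; have -> // : #|[pred i | Rltb 0 (w i)]| = O.
  apply: eq_card0 => i; rewrite !inE.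
  by apply/negbTE; apply: contra hpos => hi; apply/hasP; exists i; rewrite ?mem_enum.
have [k /RltbP wk hk] := exists_min w hpos.
have {}hk i : 0 < w i -> w k <= w i by move=> hi; apply: hk; [rewrite mem_enum | apply/RltbP].
(* Peel off one layer: the least positive weight is subtracted on the whole support, and [k] leaves
   the support. *)
pose U i := Rltb 0 (w i); pose w' i := w i - w k * indR (U i).
have w'0 i : 0 <= w' i.
  rewrite /w' /U /indR; case: RltbP => hi; last by have := w0 i; lra.
  by have := hk _ hi; lra.
have w'pos i : 0 < w' i -> 0 < w i.
  by have := indR_ge0 (U i); rewrite /w'; nra.
have hUU : edge_count A U <= m * \rsum_i indR (U i) by apply: hU => i /RltbP.
have hw' : \rsum_i \rsum_j (adjR A i j * Rmin (w' i) (w' j)) <= m * \rsum_i w' i.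
  apply: IH => //; last by move=> V hV; apply: hU => i /hV /w'pos.
  rewrite -ltnS; apply: leq_trans hN; apply: proper_card; apply/properP; split.
    by apply/subsetP => i; rewrite !inE => /RltbP /w'pos h; apply/RltbP.
  exists k; rewrite !inE; first by apply/RltbP.
  by apply/RltbP; rewrite /w' /U /indR; case: RltbP => //; lra.
have -> : \rsum_i w i = \rsum_i w' i + w k * \rsum_i indR (U i).
  by rewrite -Rsum_mull -big_split /=; apply: eq_bigr => i _; rewrite /w'; ring.
have -> : \rsum_i \rsum_j (adjR A i j * Rmin (w i) (w j)) =
    \rsum_i \rsum_j (adjR A i j * Rmin (w' i) (w' j)) + w k * edge_count A U.
  rewrite /edge_count -Rsum_mull -big_split /=; apply: eq_bigr => i _.
  rewrite -Rsum_mull -big_split /=; apply: eq_bigr => j _.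
  suff -> : Rmin (w i) (w j) = Rmin (w' i) (w' j) + w k * (indR (U i) * indR (U j)) by ring.
  move: (w'0 i) (w'0 j) (w0 i) (w0 j); rewrite /w' /U /indR.
  by case: RltbP => hi; case: RltbP => hj; rewrite /Rmin; do 2 case: Rle_dec; lra.
nra.
Qed.

(* A quadratic form with zero diagonal is affine in each coordinate. *)
Lemma bform_cube n (M : 'I_n -> 'I_n -> R) (c : R) :
  (forall i j, M i j = M j i) -> (forall i, M i i = 0) ->
  (forall s : 'I_n -> bool, bform M (fun i => sgn (s i)) (fun i => sgn (s i)) <= c) ->
  forall z, (forall i, -1 <= z i <= 1) -> bform M z z <= c.
Proof.
move=> Ms M0 hc z hz.
have : forall i, i \notin enum 'I_n -> z i = 1 \/ z i = -1 by move=> i; rewrite mem_enum.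
elim: (enum 'I_n) z hz => [|k l IH] z hz zl.
  have zs i : z i = sgn (Rltb 0 (z i)).
    by rewrite /sgn; case: RltbP; case: (zl i isT); lra.
  by apply: Rle_trans (hc (fun i => Rltb 0 (z i))); apply: Req_le; apply: bform_ext.
have step t : -1 <= t <= 1 -> (t = 1 \/ t = -1) ->
    bform M z z + 2 * (t - z k) * bform M z (delta_vec k) <= c.
  move=> ht t1; have := bform_sqD Ms (t - z k) z (delta_vec k).
  rewrite bform_delta M0 Rmult_0_r Rplus_0_r => <-; apply: IH => i; rewrite /delta_vec.
    by case: eqP => [->|_]; [lra | have := hz i; lra].
  move=> il; case: (eqVneq i k) => [->|ik]; first by case: t1 => ->; [left|right]; ring.
  by rewrite Rmult_0_r Rplus_0_r; apply: zl; rewrite inE negb_or ik.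
have h1 : bform M z z + 2 * (1 - z k) * bform M z (delta_vec k) <= c by apply: step; lra.
have h2 : bform M z z + 2 * (-1 - z k) * bform M z (delta_vec k) <= c by apply: step; lra.
have hk := hz k; nra.
Qed.

Lemma bformN n (M : 'I_n -> 'I_n -> R) x y : bform (fun i j => - M i j) x y = - bform M x y.
Proof.
rewrite /bform -Rsum_opp; apply: eq_bigr => i _; rewrite -Rsum_opp; apply: eq_bigr => j _; ring.
Qed.

Lemma bform_box n (M : 'I_n -> 'I_n -> R) (c be : R) z :
  (forall i j, M i j = M j i) -> (forall i, M i i = 0) -> 0 < be ->
  (forall s : 'I_n -> bool, Rabs (bform M (fun i => sgn (s i)) (fun i => sgn (s i))) <= c) ->
  (forall i, (z i) ^ 2 <= be ^ 2) -> Rabs (bform M z z) <= be ^ 2 * c.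
Proof.
move=> Ms M0 be0 hc hz.
have hy i : -1 <= / be * z i <= 1.
  have h1 : -be <= z i <= be by have := hz i; nra.
  have h2 := Rinv_0_lt_compat _ be0; have h3 : / be * be = 1 by field; lra.
  by nra.
have -> : bform M z z = be ^ 2 * bform M (fun i => / be * z i) (fun i => / be * z i).
  by rewrite bformZl bformZr; field; lra.
rewrite Rabs_mult (Rabs_pos_eq (be ^ 2)); last exact: pow2_ge_0.
apply: Rmult_le_compat_l; first exact: pow2_ge_0.
apply: Rabs_le; split.
  suff : - bform M (fun i => / be * z i) (fun i => / be * z i) <= c by lra.
  rewrite -bformN; apply: bform_cube => //.
  - by move=> i j; rewrite Ms.
  - by move=> i; rewrite M0; ring.
  - by move=> s; rewrite bformN; have := hc s; split_Rabs; lra.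
by apply: bform_cube => // s; have := hc s; split_Rabs; lra.
Qed.

(** Vertex weight for [layer_cake]: the cutoff keeps every level set small enough for the sparsity
    hypothesis. *)
Definition sq_above (t v : R) : R := if Rltb t (v ^ 2) then v ^ 2 else 0.

Section SpectralBound.

Variables (n : nat) (p q a L C m kap e B del : R) (sigma : 'I_n -> bool) (A : graph n).
Local Notation W := (noise p q sigma A).

Hypotheses (n_gt0 : 0 < INR n) (Avalid : adj_valid A) (L_ge0 : 0 <= L) (m_ge0 : 0 <= m).
Hypotheses (pL : 0 <= p <= a * L / INR n) (qL : 0 <= q <= a * L / INR n).
Hypotheses (B_gt0 : 0 < B) (del01 : 0 < del <= 1) (kapB : 1 <= kap * (del ^ 2 * B ^ 2)).
Hypothesis degree_le : forall i, \rsum_j adjR A i j <= C * L.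
Hypothesis sparse : forall U : 'I_n -> bool, \rsum_i indR (U i) <= kap * INR n ->
  edge_count A U <= m * L * \rsum_i indR (U i).
Hypothesis signs : forall s : 'I_n -> bool,
  Rabs (bform W (fun i => sgn (s i)) (fun i => sgn (s i))) <= e * INR n * L.

(** If [|y| <= del |x|], the product is charged to [x ^ 2], later summed by the degree bound.
    Otherwise both squares exceed [del ^ 2 * be2], so the minimum is [y ^ 2], which dominates
    [del |x y|]. *)
Lemma edge_weight_le x y be2 : be2 < x ^ 2 -> y ^ 2 <= x ^ 2 -> 0 <= be2 ->
  Rabs (x * y) <= del * x ^ 2
    + / del * Rmin (sq_above (del ^ 2 * be2) x) (sq_above (del ^ 2 * be2) y).
Proof.
move=> hx hyx hbe; set w := sq_above _; have di := Rinv_0_lt_compat _ (proj1 del01).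
have w0 v : 0 <= w v by rewrite /w /sq_above; case: RltbP => _; [apply: pow2_ge_0 | lra].
have xa := pow2_abs x; have ya := pow2_abs y.
have ax := Rabs_pos x; have ay := Rabs_pos y.
rewrite Rabs_mult; case: (Rle_dec (Rabs y) (del * Rabs x)) => h.
  have h1 : 0 <= / del * Rmin (w x) (w y).
    by apply: Rmult_le_pos; [lra | apply: Rmin_glb].
  nra.
have hy : del ^ 2 * x ^ 2 < y ^ 2.
  have dx : 0 <= del * Rabs x by apply: Rmult_le_pos; lra.
  have : 0 < (Rabs y - del * Rabs x) * (Rabs y + del * Rabs x) by apply: Rmult_lt_0_compat; lra.
  by rewrite -xa -ya; lra.
have hby : del ^ 2 * be2 < y ^ 2 by have := pow2_ge_0 del; nra.
have -> : Rmin (w x) (w y) = y ^ 2.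
  by rewrite /w /sq_above; case: RltbP => h1; case: RltbP => h2; rewrite ?Rmin_right //; lra.
have : Rabs x <= / del * Rabs y.
  apply: (Rmult_le_reg_l del); first lra.
  by rewrite -Rmult_assoc Rinv_r; lra.
have := Rmult_le_pos del (x ^ 2) (Rlt_le _ _ (proj1 del01)) (pow2_ge_0 x).
rewrite -ya; nra.
Qed.

Lemma sq_large_count x be2 : 0 < be2 ->
  be2 * \rsum_i indR (Rltb be2 ((x i) ^ 2)) <= \big[Rplus/0]_(i : 'I_n) (x i) ^ 2.
Proof.
move=> hbe; rewrite -Rsum_mull; apply: Rsum_le => i _; rewrite /indR.
by have := pow2_ge_0 (x i); case: RltbP; lra.
Qed.

Lemma mean_mx_bounds i j : 0 <= mean_mx p q sigma i j <= a * L / INR n.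
Proof.
have := pL; have := qL; rewrite /mean_mx; case: eqP => _; [lra | case: eqP => _; lra].
Qed.

(* Vertices with [x_i^2 > B^2 |x|^2 / n] are few: the form restricted to the other ones is bounded
   by its values at sign vectors, the edges at the exceptional vertices by degrees and sparsity. *)
Lemma noise_form_le x :
  Rabs (bform W x x) <= L * (B ^ 2 * e + 2 * a / B + 2 * del * C + m / del) * \rsum_i (x i) ^ 2.
Proof.
set N2 := \rsum_i _.
have N2_ge0 : 0 <= N2 by apply: Rsum_ge0 => i _; apply: pow2_ge_0.
have xi_le i : (x i) ^ 2 <= N2 by apply: (@Rsum_term_le _ (fun i => (x i) ^ 2)) => j; apply: pow2_ge_0.
case: N2_ge0 => [N2_gt0|N20]; last first.
  have x0 i : x i = 0 by have := xi_le i; rewrite -N20; nra.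
  rewrite -N20 Rmult_0_r /bform big1 ?Rabs_R0; first lra.
  by move=> i _; rewrite big1 // => j _; rewrite x0; ring.
pose be2 := B ^ 2 * N2 / INR n.
have B2 : 0 < B ^ 2 by nra.
have d2 : 0 < del ^ 2 by nra.
have be2_gt0 : 0 < be2 by apply: Rdiv_lt_0_compat => //; nra.
have be2n : be2 * INR n = B ^ 2 * N2 by rewrite /be2; field; lra.
pose T i := Rltb be2 ((x i) ^ 2); pose z i := if T i then 0 else x i.
pose w i := sq_above (del ^ 2 * be2) (x i).
have w_ge0 i : 0 <= w i by rewrite /w /sq_above; case: ifP => _; [apply: pow2_ge_0 | lra].
have hz : Rabs (bform W z z) <= B ^ 2 * e * L * N2.
  have sb : (sqrt be2) ^ 2 = be2 by rewrite /= Rmult_1_r sqrt_sqrt; lra.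
  have -> : B ^ 2 * e * L * N2 = (sqrt be2) ^ 2 * (e * INR n * L).
    by rewrite sb; transitivity (be2 * INR n * (e * L)); [rewrite be2n|]; ring.
  apply: bform_box => //.
  - by move=> i j; apply: noise_sym.
  - move=> i; rewrite /noise /mean_mx eqxx /adjR.
    by case/adj_validP: Avalid => -> _; ring.
  - exact: sqrt_lt_R0.
  - by move=> i; rewrite sb /z /T; case: RltbP; lra.
have hT : B ^ 2 * \rsum_i indR (T i) <= INR n.
  apply: (Rmult_le_reg_r N2) => //.
  have -> : B ^ 2 * \rsum_i indR (T i) * N2 = INR n * (be2 * \rsum_i indR (T i)).
    by rewrite -Rmult_assoc (Rmult_comm (INR n)) be2n; ring.
  by apply: Rmult_le_compat_l; [lra | apply: sq_large_count].
have hU : \rsum_i indR (Rltb (del ^ 2 * be2) ((x i) ^ 2)) <= kap * INR n.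
  have d2be : 0 < del ^ 2 * be2 by nra.
  have := sq_large_count x d2be; set u := \rsum_i indR _ => hu.
  have u_ge0 : 0 <= u by apply: Rsum_ge0 => i _; apply: indR_ge0.
  have h1 : (del ^ 2 * B ^ 2) * u <= INR n.
    apply: (Rmult_le_reg_r N2) => //.
    have -> : del ^ 2 * B ^ 2 * u * N2 = INR n * (del ^ 2 * be2 * u).
      by transitivity (del ^ 2 * u * (be2 * INR n)); [rewrite be2n|]; ring.
    by apply: Rmult_le_compat_l; [lra | exact: hu].
  have dB : 0 < del ^ 2 * B ^ 2 by nra.
  apply: (Rmult_le_reg_l (del ^ 2 * B ^ 2)) => //.
  by apply: Rle_trans h1 _; nra.
have hlayer : \rsum_i \rsum_j (adjR A i j * Rmin (w i) (w j)) <= m * L * N2.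
  apply: Rle_trans (layer_cake w_ge0 (m := m * L) _) _.
    move=> U hUw; apply: sparse; apply: Rle_trans hU; apply: Rsum_le => i _.
    rewrite /indR; case: ifP => Ui; last by case: ifP => _; lra.
    by move: (hUw i Ui); rewrite /w /sq_above; case: ifP => _; lra.
  apply: Rmult_le_compat_l; first exact: Rmult_le_pos.
  by apply: Rsum_le => i _; rewrite /w /sq_above; case: ifP => _; [lra | apply: pow2_ge_0].
(* [g i j] is [|x_i x_j - z_i z_j|]. It needs two bounds: [g_light] against the mean matrix, whose
   entries are uniformly small, and [g_heavy] against the graph. *)
pose g i j := if T i || T j then Rabs (x i * x j) else 0.
(* Weighted AM-GM: as at most [n / B ^ 2] vertices lie in [T], the weights [1 / B] and [B] make each
   of the two sums at most [n N2 / B]. *)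
pose h i j := indR (T i) * ((x i) ^ 2 / B + B * (x j) ^ 2) / 2.
have g_light i j : g i j <= h i j + h j i.
  have h0 k l : 0 <= h k l.
    rewrite /h; apply: Rmult_le_pos; last lra.
    apply: Rmult_le_pos; first exact: indR_ge0.
    apply: Rplus_le_le_0_compat; last by apply: Rmult_le_pos; [lra | apply: pow2_ge_0].
    by apply: Rmult_le_pos; [apply: pow2_ge_0 | have := Rinv_0_lt_compat _ B_gt0; lra].
  have amgm k l : T k -> Rabs (x k * x l) <= h k l.
    move=> Tk; rewrite /h Tk /indR Rmult_1_l.
    have -> : (x k ^ 2 / B + B * x l ^ 2) / 2
      = x k * x l + (x k - B * x l) ^ 2 / B / 2 by field; lra.
    have h1 : 0 <= (x k - B * x l) ^ 2 / B / 2.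
      by have := Rinv_0_lt_compat _ B_gt0; have := pow2_ge_0 (x k - B * x l); rewrite /Rdiv; nra.
    have h2 : 0 <= (x k + B * x l) ^ 2 / B / 2.
      by have := Rinv_0_lt_compat _ B_gt0; have := pow2_ge_0 (x k + B * x l); rewrite /Rdiv; nra.
    have h3 : (x k + B * x l) ^ 2 / B / 2 = (x k - B * x l) ^ 2 / B / 2 + 2 * (x k * x l).
      by field; lra.
    by split_Rabs; lra.
  rewrite /g; case: ifP => [/orP [Ti|Tj]|_].
  - by have := amgm i j Ti; have := h0 j i; lra.
  - by have := amgm j i Tj; have := h0 i j; rewrite (Rmult_comm (x j)); lra.
  - by have := h0 i j; have := h0 j i; lra.
have g_heavy i j : g i j <= del * ((x i) ^ 2 + (x j) ^ 2) + / del * Rmin (w i) (w j).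
  have hi := pow2_ge_0 (x i); have hj := pow2_ge_0 (x j).
  have di := Rinv_0_lt_compat _ (proj1 del01).
  have hm : 0 <= / del * Rmin (w i) (w j) by apply: Rmult_le_pos; [lra | apply: Rmin_glb].
  rewrite /g; case: ifP => Tij; last by nra.
  case: (Rle_dec ((x j) ^ 2) ((x i) ^ 2)) => hij.
    have Ti : be2 < (x i) ^ 2 by case/orP: Tij => /RltbP; lra.
    have := @edge_weight_le (x i) (x j) be2 Ti hij (Rlt_le _ _ be2_gt0).
    by rewrite -/(w i) -/(w j); have := Rmult_le_pos _ _ (Rlt_le _ _ (proj1 del01)) hj; lra.
  have Tj : be2 < (x j) ^ 2 by case/orP: Tij => /RltbP; lra.
  have := @edge_weight_le (x j) (x i) be2 Tj _ (Rlt_le _ _ be2_gt0).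
  rewrite -/(w i) -/(w j) Rmin_comm (Rmult_comm (x j)) => /(_ ltac:(lra)).
  by have := Rmult_le_pos _ _ (Rlt_le _ _ (proj1 del01)) hi; lra.
have sumA : \rsum_i \rsum_j (adjR A i j * g i j) <= (2 * del * C + m / del) * L * N2.
  have degx : \rsum_i \rsum_j (adjR A i j * (x i) ^ 2) <= C * L * N2.
    rewrite -Rsum_mull; apply: Rsum_le => i _; rewrite Rsum_mulr.
    by apply: Rmult_le_compat_r; [apply: pow2_ge_0 | apply: degree_le].
  have degx' : \rsum_i \rsum_j (adjR A i j * (x j) ^ 2) <= C * L * N2.
    rewrite exchange_big /=; apply: Rle_trans degx; apply: Req_le.
    apply: eq_bigr => i _; apply: eq_bigr => j _.
    by case/adj_validP: Avalid => _ As; rewrite /adjR As.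
  apply: Rle_trans (_ : del * (\rsum_i \rsum_j (adjR A i j * (x i) ^ 2)
     + \rsum_i \rsum_j (adjR A i j * (x j) ^ 2))
     + / del * \rsum_i \rsum_j (adjR A i j * Rmin (w i) (w j)) <= _).
    rewrite -big_split -!Rsum_mull -big_split /=; apply: Rsum_le => i _.
    rewrite -big_split -!Rsum_mull -big_split /=; apply: Rsum_le => j _.
    have := Rmult_le_compat_l _ _ _ (adjR_ge0 A i j) (g_heavy i j) => h1.
    by apply: Rle_trans h1 _; apply: Req_le; rewrite /=; ring.
  have di := Rinv_0_lt_compat _ (proj1 del01).
  have -> : (2 * del * C + m / del) * L * N2 = del * (C * L * N2 + C * L * N2) + / del * (m * L * N2).
    by field; lra.
  by apply: Rplus_le_compat; apply: Rmult_le_compat_l; lra.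
have sumh : \rsum_i \rsum_j h i j <= INR n * N2 / B.
  have -> : \rsum_i \rsum_j h i j =
      (INR n / B * \rsum_i (indR (T i) * (x i) ^ 2) + B * N2 * \rsum_i indR (T i)) / 2.
    rewrite -(Rsum_mull (fun i => indR (T i) * (x i) ^ 2)) -(Rsum_mull (fun i => indR (T i))).
    rewrite -big_split /= /Rdiv -Rsum_mulr; apply: eq_bigr => i _.
    transitivity (\rsum_j (indR (T i) * (x i) ^ 2 / B / 2 + indR (T i) * B / 2 * (x j) ^ 2)).
      by apply: eq_bigr => j _; rewrite /h; field; lra.
    have -> : \rsum_j (indR (T i) * (x i) ^ 2 / B / 2 + indR (T i) * B / 2 * (x j) ^ 2) =
      INR n * (indR (T i) * (x i) ^ 2 / B / 2) + indR (T i) * B / 2 * N2.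
      by rewrite -Rsum_const_ord /N2 -Rsum_mull -big_split.
    by field; lra.
  have h1 : \rsum_i (indR (T i) * (x i) ^ 2) <= N2.
    by apply: Rsum_le => i _; have := pow2_ge_0 (x i); rewrite /indR; case: (T i); lra.
  have h2 : INR n / B * \rsum_i (indR (T i) * (x i) ^ 2) <= INR n * N2 / B.
    have -> : INR n * N2 / B = INR n / B * N2 by field; lra.
    apply: Rmult_le_compat_l => //; apply: Rlt_le; exact: Rdiv_lt_0_compat.
  have h3 : B * N2 * \rsum_i indR (T i) <= INR n * N2 / B.
    have -> : B * N2 * \rsum_i indR (T i) = N2 / B * (B ^ 2 * \rsum_i indR (T i)) by field; lra.
    have -> : INR n * N2 / B = N2 / B * INR n by field; lra.
    apply: Rmult_le_compat_l => //; apply: Rlt_le; exact: Rdiv_lt_0_compat.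
  lra.
have sumM : \rsum_i \rsum_j (mean_mx p q sigma i j * g i j) <= 2 * a / B * L * N2.
  have aL : 0 <= a * L / INR n by have := pL; lra.
  apply: Rle_trans (_ : a * L / INR n * (\rsum_i \rsum_j h i j + \rsum_i \rsum_j h j i) <= _).
    rewrite -big_split -Rsum_mull /=; apply: Rsum_le => i _.
    rewrite -big_split -Rsum_mull /=; apply: Rsum_le => j _.
    have hm := mean_mx_bounds i j; apply: Rmult_le_compat; [lra | | lra | exact: g_light].
    by rewrite /g; case: ifP => _; [apply: Rabs_pos | lra].
  have -> : \rsum_i \rsum_j h j i = \rsum_i \rsum_j h i j by rewrite exchange_big.
  have -> : 2 * a / B * L * N2 = a * L / INR n * (INR n * N2 / B + INR n * N2 / B) by field; lra.
  by apply: Rmult_le_compat_l => //; lra.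
have diff : Rabs (bform W x x - bform W z z) <=
    \rsum_i \rsum_j (adjR A i j * g i j) + \rsum_i \rsum_j (mean_mx p q sigma i j * g i j).
  have -> : bform W x x - bform W z z =
      \rsum_i \rsum_j (x i * W i j * x j - z i * W i j * z j).
    by rewrite /bform -Rsum_sub; apply: eq_bigr => i _; rewrite Rsum_sub.
  refine (Rle_trans _ _ _ (Rabs_sum_le _) _); rewrite -big_split /=; apply: Rsum_le => i _.
  refine (Rle_trans _ _ _ (Rabs_sum_le _) _); rewrite -big_split /=; apply: Rsum_le => j _.
  have -> : x i * W i j * x j - z i * W i j * z j = W i j * (x i * x j - z i * z j) by ring.
  have -> : adjR A i j * g i j + mean_mx p q sigma i j * g i j =
     (adjR A i j + mean_mx p q sigma i j) * g i j by ring.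
  rewrite Rabs_mult.
  have -> : Rabs (x i * x j - z i * z j) = g i j.
    rewrite /g /z; case: (T i); case: (T j) => /=; rewrite ?Rmult_0_l ?Rmult_0_r ?Rminus_0_r //.
    by rewrite Rminus_diag Rabs_R0.
  apply: Rmult_le_compat_r; first by rewrite /g; case: ifP => _; [apply: Rabs_pos | lra].
  by have := adjR_ge0 A i j; have := mean_mx_bounds i j; rewrite /noise; split_Rabs; lra.
have -> : L * (B ^ 2 * e + 2 * a / B + 2 * del * C + m / del) * N2 =
  B ^ 2 * e * L * N2 + 2 * a / B * L * N2 + (2 * del * C + m / del) * L * N2 by ring.
by move: hz diff sumA sumM; split_Rabs; lra.
Qed.

End SpectralBound.

(** * Chernoff exponents and eta *)

Lemma ln_lt_sub1 x : 0 < x -> x <> 1 -> ln x < x - 1.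
Proof.
move=> x0 x1; have lx : ln x <> 0 by move=> h; apply: x1; rewrite -(exp_ln x x0) h exp_0.
by have := exp_ineq1 (ln x) lx; rewrite exp_ln //; lra.
Qed.

Lemma ln_ge0 x : 1 <= x -> 0 <= ln x.
Proof. by rewrite -ln_1 => -[h|<-]; [left; apply: ln_increasing; lra | lra]. Qed.

Lemma ln_quot x y : 0 < x -> 0 < y -> ln (x / y) = ln x - ln y.
Proof.
move=> x0 y0; rewrite /Rdiv ln_mult ?ln_Rinv //; exact: Rinv_0_lt_compat.
Qed.

Section ChernoffExponents.

Variables a b rho : R.
Hypotheses (b_gt0 : 0 < b) (ba : b < a) (rho_gt0 : 0 < rho) (rho_le : rho <= 1 / 2).

Local Notation T := (tau a b).
Local Notation G := (gam rho a b).
Local Notation c := (1 - rho - rho).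

Lemma ln_sub_gt0 : 0 < ln a - ln b.
Proof. by have := ln_increasing b a b_gt0 ba; lra. Qed.

Lemma tau_mul : T * (ln a - ln b) = a - b.
Proof. by have := ln_sub_gt0; rewrite /tau; move=> h; field; lra. Qed.

(** [tau] is the logarithmic mean of [a] and [b]; both bounds are [ln x < x - 1], at [a / b] and at
    [b / a]. *)
Lemma tau_bounds : b < T < a.
Proof.
have l0 := ln_sub_gt0; have tm := tau_mul.
have h1 : ln (a / b) < a / b - 1.
  apply: ln_lt_sub1; first by apply: Rdiv_lt_0_compat; lra.
  move=> h; have : a = b by rewrite -[LHS](_ : a / b * b = a); [rewrite h; ring | field; lra].
  by lra.
have h2 : ln (b / a) < b / a - 1.
  apply: ln_lt_sub1; first by apply: Rdiv_lt_0_compat; lra.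
  move=> h; have : b = a by rewrite -[LHS](_ : b / a * a = b); [rewrite h; ring | field; lra].
  by lra.
rewrite ln_quot in h1; [| lra | lra]; rewrite ln_quot in h2; [| lra | lra].
have e1 : b * (a / b - 1) = a - b by field; lra.
have e2 : a * (b / a - 1) = b - a by field; lra.
split; apply: (Rmult_lt_reg_r (ln a - ln b)) => //; rewrite tm.
  by rewrite -e1; apply: Rmult_lt_compat_l; lra.
have : a * (ln b - ln a) < a * (b / a - 1) by apply: Rmult_lt_compat_l; lra.
by rewrite e2; lra.
Qed.

Lemma gam_sq : G ^ 2 = c ^ 2 * T ^ 2 + 4 * rho * (1 - rho) * a * b.
Proof.
rewrite /gam pow2_sqrt //.
have h1 := pow2_ge_0 (c * T).
have h2 : 0 < rho * (1 - rho) * (a * b) by apply: Rmult_lt_0_compat; apply: Rmult_lt_0_compat; lra.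
by lra.
Qed.

Lemma gam_ge0 : 0 <= G. Proof. exact: sqrt_pos. Qed.

Lemma le_gam x : x ^ 2 <= c ^ 2 * T ^ 2 + 4 * rho * (1 - rho) * a * b -> x <= G.
Proof. by rewrite -gam_sq; have := gam_ge0; nra. Qed.

Lemma gam_gt : c * T < G.
Proof.
have [tb ta] := tau_bounds; have g := gam_sq; have g0 := gam_ge0.
have h2 : 0 < rho * (1 - rho) * (a * b).
  by apply: Rmult_lt_0_compat; apply: Rmult_lt_0_compat; lra.
have cT : 0 <= c * T by apply: Rmult_le_pos; lra.
by nra.
Qed.

Lemma gam_prod : (G + c * T) * (G - c * T) = 4 * rho * (1 - rho) * a * b.
Proof. by have := gam_sq => h; transitivity (G ^ 2 - c ^ 2 * T ^ 2); [ring | rewrite h; ring]. Qed.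

(** Positive roots of [(1 - rho) b y ^ 2 - c T y - rho a] and [rho b y ^ 2 + c T y - (1 - rho) a],
    the stationarity equations for the small and the large cluster. *)
Let y1 := (G + c * T) / (2 * (1 - rho) * b).
Let y2 := (G - c * T) / (2 * rho * b).

Let y1_gt0 : 0 < y1.
Proof.
have := gam_gt; have [tb ta] := tau_bounds => h.
have cT : 0 <= c * T by apply: Rmult_le_pos; lra.
by apply: Rdiv_lt_0_compat; [lra | nra].
Qed.

Let y2_gt0 : 0 < y2.
Proof. by have := gam_gt => h; apply: Rdiv_lt_0_compat; [lra | nra]. Qed.

(** This relation, with [tau_mul], is what makes the exponents of the two clusters coincide. *)
Let y12 : y1 * y2 = a / b.
Proof.
rewrite /y1 /y2.
transitivity ((G + c * T) * (G - c * T) / (2 * (1 - rho) * b * (2 * rho * b))); first by field; lra.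
by rewrite gam_prod; field; lra.
Qed.

(** Makes the tilt [ln y1] nonnegative, as a lower-tail Chernoff bound requires. *)
Let y1_ge1 : 1 <= y1.
Proof.
apply: (Rmult_le_reg_r (2 * (1 - rho) * b)); first by nra.
have -> : y1 * (2 * (1 - rho) * b) = G + c * T by rewrite /y1; field; lra.
suff : 2 * (1 - rho) * b - c * T <= G by lra.
apply: le_gam; have [tb ta] := tau_bounds.
(* A quarter of [G ^ 2 - (2 (1 - rho) b - c T) ^ 2]. *)
have h : 0 <= (1 - rho) * b * (rho * (a - b) + c * (T - b)).
  by apply: Rmult_le_pos; [nra | apply: Rplus_le_le_0_compat; apply: Rmult_le_pos; lra].
by lra.
Qed.

Let y2_ge1 : 1 <= y2.
Proof.
apply: (Rmult_le_reg_r (2 * rho * b)); first by nra.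
have -> : y2 * (2 * rho * b) = G - c * T by rewrite /y2; field; lra.
suff : 2 * rho * b + c * T <= G by lra.
apply: le_gam; have [tb ta] := tau_bounds.
have h : 0 <= rho * b * (rho * (a - b) + c * (a - T)).
  by apply: Rmult_le_pos; [nra | apply: Rplus_le_le_0_compat; apply: Rmult_le_pos; lra].
by lra.
Qed.

(** The ratio inside the logarithm of [eta] equals [y1 ^ 2 * b / a]. *)
Let etaE : eta rho a b = (a + b) / 2 - G + c * (T * ln y1 - (a - b) / 2).
Proof.
have g := gam_gt; have gp := gam_prod; have [tb ta] := tau_bounds.
have cT : 0 <= c * T by apply: Rmult_le_pos; lra.
rewrite /eta; case: Req_EM_T => [h|h] /=; first lra.
set Z := _ / ((1 - rho) * _).
have Z_gt0 : 0 < Z by apply: Rdiv_lt_0_compat; apply: Rmult_lt_0_compat; lra.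
have ab_gt0 : 0 < a / b by apply: Rdiv_lt_0_compat; lra.
have yZ : y1 * y1 = Z * (a / b).
  rewrite /Z /y1.
  have -> : rho * (G + c * T) / ((1 - rho) * (G - c * T)) * (a / b) =
     rho * a * (G + c * T) ^ 2 / ((1 - rho) * b * ((G + c * T) * (G - c * T))) by field; lra.
  by rewrite gp; field; lra.
have l : 2 * ln y1 = ln Z + (ln a - ln b).
  rewrite -ln_quot; [| lra | lra]; rewrite -ln_mult // -yZ ln_mult //; ring.
have -> : ln Z = 2 * ln y1 - (ln a - ln b) by lra.
rewrite -tau_mul; field.
Qed.

(* The optimal tilts: [exp theta] is the positive root of the derivative of the exponent,
   a quadratic equation with discriminant [gam ^ 2]. *)
Lemma exponent_minority : exists2 th, 0 <= th &
  - th * T * c + rho * a * (exp (- th) - 1) + (1 - rho) * b * (exp th - 1) = - eta rho a b.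
Proof.
have g := gam_gt; have gp := gam_prod; have [tb ta] := tau_bounds.
have cT : 0 <= c * T by apply: Rmult_le_pos; lra.
exists (ln y1); first exact: ln_ge0.
rewrite exp_Ropp exp_ln // etaE.
have -> : rho * a * (/ y1 - 1) = (G - c * T) / 2 - rho * a.
  have -> : / y1 = (G + c * T) * (G - c * T) / (G + c * T) / (2 * rho * a).
    by rewrite gp /y1; field; lra.
  by field; lra.
have -> : (1 - rho) * b * (y1 - 1) = (G + c * T) / 2 - (1 - rho) * b by rewrite /y1; field; lra.
by field.
Qed.

Lemma exponent_majority : exists2 th, 0 <= th &
  th * T * c + (1 - rho) * a * (exp (- th) - 1) + rho * b * (exp th - 1) = - eta rho a b.
Proof.
have g := gam_gt; have gp := gam_prod; have [tb ta] := tau_bounds.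
have cT : 0 <= c * T by apply: Rmult_le_pos; lra.
exists (ln y2); first exact: ln_ge0.
rewrite exp_Ropp exp_ln // etaE.
have -> : (1 - rho) * a * (/ y2 - 1) = (G + c * T) / 2 - (1 - rho) * a.
  have -> : / y2 = (G + c * T) * (G - c * T) / (G - c * T) / (2 * (1 - rho) * a).
    by rewrite gp /y2; field; lra.
  by field; lra.
have -> : rho * b * (y2 - 1) = (G - c * T) / 2 - rho * b by rewrite /y2; field; lra.
have l : ln y2 = ln a - ln b - ln y1.
  by rewrite -ln_quot; [| lra | lra]; rewrite -y12 ln_mult //; ring.
have -> : ln y2 * T * c = c * (a - b) - c * (T * ln y1) by rewrite l -tau_mul; ring.
by field.
Qed.

End ChernoffExponents.

(** * Probability of the bad events *)

Lemma exp_quadratic x : x <= 1 / 2 -> exp x - 1 - x <= 2 * x ^ 2.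
Proof.
move=> hx; have h1 := exp_ineq1_le (- x); have h2 : exp x * exp (- x) = 1.
  by rewrite -exp_plus Rplus_opp_r exp_0.
have h3 := exp_pos x; have h4 : exp x * (1 - x) <= 1 by nra.
have h5 : 1 <= (1 + x + 2 * x ^ 2) * (1 - x).
  have : 0 <= x ^ 2 * (1 - 2 * x) by apply: Rmult_le_pos; [apply: pow2_ge_0 | lra].
  by lra.
suff : exp x <= 1 + x + 2 * x ^ 2 by lra.
by apply: (Rmult_le_reg_r (1 - x)); lra.
Qed.

Lemma exp_le_compat x y : x <= y -> exp x <= exp y.
Proof. by case=> [/exp_increasing|->]; lra. Qed.

Lemma exp_INR_ln n x : 0 < INR n -> INR n * exp x = exp (ln (INR n) + x).
Proof. by move=> n0; rewrite exp_plus exp_ln. Qed.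

Section Events.

Variables (n : nat) (a b : R) (sigma : 'I_n -> bool).
Local Notation L := (ln (INR n)).
Local Notation p := (a * L / INR n).
Local Notation q := (b * L / INR n).
Local Notation Pr := (sbm_prob a b sigma).
Local Notation p_ := (edge_prob a b sigma).

Hypotheses (b_gt0 : 0 < b) (ba : b < a) (n_gt0 : 0 < INR n) (L_gt0 : 0 < L) (p_le1 : p <= 1).

Lemma edge_prob_bounds i j : 0 <= p_ i j <= p.
Proof.
have h : 0 < L / INR n by apply: Rdiv_lt_0_compat.
have -> : p = a * (L / INR n) by field; lra.
rewrite /edge_prob; case: eqP => _.
  have -> : p = a * (L / INR n) by field; lra.
  by nra.
have -> : q = b * (L / INR n) by field; lra.
by nra.
Qed.

Let p01 i j : 0 <= p_ i j <= 1.
Proof. by have := edge_prob_bounds i j; lra. Qed.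

Let p_gt0 : 0 < p.
Proof. by apply: Rdiv_lt_0_compat => //; nra. Qed.

(** With tilt 1 and [exp 1 - 1 <= 2] the exponent is at most [- (2 a + 2) L + 2 a L = - 2 L]; the
    union over vertices costs one [L]. *)
Lemma degree_tail :
  Pr (fun A => exists2 i, true & (2 * a + 2) * L <= \rsum_j adjR A i j) <= exp (- L).
Proof.
apply: Rle_trans (sbm_prob_exists p01 _ _) _.
apply: Rle_trans (_ : \big[Rplus/0]_(i : 'I_n) exp (- 2 * L) <= _); last first.
  by rewrite Rsum_const_ord exp_INR_ln //; apply: exp_le_compat; lra.
apply: Rsum_le => v _.
apply: Rle_trans (Rle_trans _ _ _ _ (sbm_chernoff_row p01 v (fun=> 1) ((2 * a + 2) * L))) _.
  apply: sbm_prob_mono => // A _ h; apply: Rle_trans h _; apply: Req_le.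
  by apply: eq_bigr => j _; ring.
apply: exp_le_compat.
have e3 := exp_le_3; have e1 := exp_ineq1_le 1.
have : \big[Rplus/0]_(j | j != v) (p_ v j * (exp 1 - 1)) <= \big[Rplus/0]_(j : 'I_n) (p * 2).
  apply: Rle_trans (Rsum_subset_le (fun j => j != v) _); last by move=> _; lra.
  by apply: Rsum_le => j _; have := edge_prob_bounds v j; nra.
rewrite Rsum_const_ord.
have -> : INR n * (p * 2) = 2 * a * L by field; lra.
by lra.
Qed.

Lemma edge_count_tail (U : 'I_n -> bool) (th t : R) : 0 <= th ->
  Pr (fun A => t <= edge_count A U)
  <= exp (- (th * t / 2) + p * exp th * (\rsum_i indR (U i)) ^ 2 / 2).
Proof.
move=> th0; pose c (i j : 'I_n) := if i == j then 0 else th * (indR (U i) * indR (U j)).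
have cs i j : c i j = c j i by rewrite /c eq_sym; case: ifP => _; ring.
have c0 i : c i i = 0 by rewrite /c eqxx.
apply: Rle_trans (Rle_trans _ _ _ _ (@sbm_chernoff n a b sigma p01 c (th * t) cs c0)) _.
  apply: sbm_prob_mono => // A /adj_validP [A0 _] h.
  have -> : \rsum_i \rsum_j (c i j * adjR A i j) = th * edge_count A U.
    rewrite /edge_count -Rsum_mull; apply: eq_bigr => i _; rewrite -Rsum_mull.
    apply: eq_bigr => j _; rewrite /c; case: eqP => [<-|_]; last ring.
    by rewrite /adjR A0; ring.
  by apply: Rmult_le_compat_l.
apply: exp_le_compat.
suff : \rsum_i \rsum_j (p_ i j * (exp (c i j) - 1)) <= p * exp th * (\rsum_i indR (U i)) ^ 2 by lra.
have -> : p * exp th * (\rsum_i indR (U i)) ^ 2 =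
    \rsum_i \rsum_j (p * exp th * (indR (U i) * indR (U j))).
  rewrite /= Rmult_1_r -Rsum_mulr -Rsum_mull; apply: eq_bigr => i _.
  by rewrite -Rsum_mull -Rsum_mull; apply: eq_bigr => j _; ring.
apply: Rsum_le => i _; apply: Rsum_le => j _; have hp := edge_prob_bounds i j.
have e1 := exp_ineq1_le th.
have hi := indR_ge0 (U i); have hj := indR_ge0 (U j).
have hR : 0 <= p * exp th * (indR (U i) * indR (U j)).
  by apply: Rmult_le_pos; apply: Rmult_le_pos; lra.
rewrite /c; case: eqP => [_|_]; first by rewrite exp_0; lra.
move: hR; rewrite /indR; case: (U i); case: (U j); rewrite ?Rmult_0_l ?Rmult_0_r ?exp_0 ?Rmult_1_r.
all: nra.
Qed.

Lemma sum_ffun_bool (x : R) :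
  \big[Rplus/0]_(U : {ffun 'I_n -> bool}) \big[Rmult/1]_i (if U i then x else 1) =
  \big[Rmult/1]_(i : 'I_n) (x + 1).
Proof.
rewrite -(bigA_distr_bigA (fun (_ : 'I_n) (c : bool) => if c then x else 1)) /=.
by apply: eq_bigr => i _; rewrite big_bool.
Qed.

(** Each [U] fails with probability at most [exp (- L - L |U|)]: [th * m = 6] yields [- 3 L |U|],
    and smallness of [U] limits the mean term to [L |U| / 2]. The sum of [exp (- L |U|)] over all
    [U] is [(1 + 1 / n) ^ n], so subsets need not be counted by size. The empty set is excluded
    because it satisfies the weak inequality trivially. *)
Lemma sparse_tail (m kap th : R) :
  0 < m -> th * m = 6 -> 0 <= th -> kap * (a * exp th) <= 1 ->
  Pr (fun A => exists2 U : {ffun 'I_n -> bool},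
        [exists i, U i]
        & \rsum_i indR (U i) <= kap * INR n /\
        m * L * \rsum_i indR (U i) <= edge_count A U) <= 3 * exp (- L).
Proof.
move=> m0 thm th0 hkap; apply: Rle_trans (sbm_prob_exists p01 _ _) _.
apply: Rle_trans (_ : \big[Rplus/0]_(U : {ffun 'I_n -> bool})
   (exp (- L) * \big[Rmult/1]_i (if U i then exp (- L) else 1)) <= _); last first.
  rewrite Rsum_mull sum_ffun_bool Rmult_comm; apply: Rmult_le_compat_r.
    by have := exp_pos (- L); lra.
  apply: Rle_trans (_ : \big[Rmult/1]_(i : 'I_n) exp (exp (- L)) <= _).
    apply: Rprod_le => i _; have := exp_pos (- L); have := exp_ineq1_le (exp (- L)); lra.
  rewrite Rprod_exp Rsum_const_ord exp_INR_ln // Rplus_opp_r exp_0.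
  exact: exp_le_3.
rewrite big_mkcond /=; apply: Rsum_le => U _.
set u := \rsum_i indR (U i).
have prodE : \big[Rmult/1]_i (if U i then exp (- L) else 1) = exp (- L * u).
  rewrite /u -Rsum_mull -Rprod_exp; apply: eq_bigr => i _.
  by rewrite /indR; case: (U i); rewrite ?Rmult_1_r // Rmult_0_r exp_0.
rewrite prodE -exp_plus.
have R0 := exp_pos (- L + - L * u).
case: ifP => [/existsP [i Ui]|_]; last lra.
have u1 : 1 <= u.
  apply: Rle_trans (Rsum_term_le i (fun j => indR_ge0 (U j))); rewrite Ui /indR; lra.
case: (Rle_dec u (kap * INR n)) => hu; last first.
  apply: Rle_trans (_ : Pr (fun=> False) <= _).
    by apply: sbm_prob_mono => // A _ [].
  rewrite /sbm_prob big1; first lra.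
  by move=> A _; case: excluded_middle_informative.
apply: Rle_trans (Rle_trans _ _ _ _ (edge_count_tail U (m * L * u) th0)) _.
  by apply: sbm_prob_mono => // A _ [].
apply: exp_le_compat; rewrite -/u.
have -> : th * (m * L * u) / 2 = 3 * (L * u).
  by transitivity ((th * m) * (L * u) / 2); [field | rewrite thm; field].
have h1 : p * exp th * u ^ 2 <= L * u.
  have -> : p * exp th * u ^ 2 = (L * u) * (a * exp th * u / INR n) by field; lra.
  rewrite -[X in _ <= X]Rmult_1_r; apply: Rmult_le_compat_l; first by nra.
  apply: (Rmult_le_reg_r (INR n)) => //.
  have -> : a * exp th * u / INR n * INR n = a * exp th * u by field; lra.
  have ae : 0 < a * exp th by apply: Rmult_lt_0_compat; [lra | apply: exp_pos].
  have h2 : a * exp th * u <= a * exp th * (kap * INR n) by apply: Rmult_le_compat_l; lra.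
  by nra.
have Lu : L <= L * u by nra.
by lra.
Qed.

Lemma mean_mx_edge_prob i j : i != j -> mean_mx p q sigma i j = p_ i j.
Proof. by move=> /negbTE ij; rewrite /mean_mx ij. Qed.

(** Bernstein-type bound: after centring, [exp_quadratic] leaves a second-order term
    [2 a th ^ 2 n L], which [4 a th <= e] keeps below half of the linear gain [th e n L]. *)
Lemma sign_tail (s : 'I_n -> bool) (up : bool) (e th : R) :
  0 < th -> th <= 1 / 2 -> 4 * a * th <= e ->
  Pr (fun A => e * INR n * L <= sgn up *
     bform (noise p q sigma A) (fun i => sgn (s i)) (fun i => sgn (s i)))
  <= exp (- (th * e / 4) * (INR n * L)).
Proof.
move=> th0 th1 the; pose v i := sgn (s i).
pose c (i j : 'I_n) := if i == j then 0 else th * (sgn up * (v i * v j)).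
have cs i j : c i j = c j i by rewrite /c eq_sym; case: ifP => _; ring.
have c0 i : c i i = 0 by rewrite /c eqxx.
(* The Chernoff bound concerns [A] itself, so the mean of the weighted sum is added back to the
   threshold. *)
pose t := th * (e * INR n * L) + \rsum_i \rsum_j (c i j * p_ i j).
apply: Rle_trans (Rle_trans _ _ _ _ (@sbm_chernoff n a b sigma p01 c t cs c0)) _.
  apply: sbm_prob_mono => // A /adj_validP [A0 _] h.
  have <- : th * (sgn up * bform (noise p q sigma A) v v) + \rsum_i \rsum_j (c i j * p_ i j)
       = \rsum_i \rsum_j (c i j * adjR A i j).
    rewrite /bform -!Rsum_mull -big_split /=; apply: eq_bigr => i _.
    rewrite -!Rsum_mull -big_split /=; apply: eq_bigr => j _; rewrite /c /noise.
    case: (eqVneq i j) => [<-|ij]; last by rewrite mean_mx_edge_prob //; ring.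
    by rewrite /mean_mx eqxx /adjR A0; ring.
  by apply: Rplus_le_compat_r; apply: Rmult_le_compat_l; [lra | exact: h].
apply: exp_le_compat.
have h : \rsum_i \rsum_j (p_ i j * (exp (c i j) - 1)) - \rsum_i \rsum_j (c i j * p_ i j)
     <= 2 * a * th ^ 2 * (INR n * L).
  have -> : 2 * a * th ^ 2 * (INR n * L) =
      \big[Rplus/0]_(i : 'I_n) \big[Rplus/0]_(j : 'I_n) (p * (2 * th ^ 2)).
    by rewrite !Rsum_const_ord; field; lra.
  rewrite -Rsum_sub; apply: Rsum_le => i _; rewrite -Rsum_sub; apply: Rsum_le => j _.
  have -> : p_ i j * (exp (c i j) - 1) - c i j * p_ i j = p_ i j * (exp (c i j) - 1 - c i j) by ring.
  have c2 : (c i j) ^ 2 <= th ^ 2 /\ c i j <= 1 / 2.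
    rewrite /c; case: eqP => _; first by have := pow2_ge_0 th; split; lra.
    by rewrite /v /sgn; case: (up); case: (s i); case: (s j); split; lra.
  have h1 := exp_quadratic (proj2 c2); have hp := edge_prob_bounds i j.
  have h2 : exp (c i j) - 1 - c i j <= 2 * th ^ 2 by lra.
  have h3 := exp_ineq1_le (c i j).
  by apply: Rmult_le_compat; lra.
have nL : 0 < INR n * L by apply: Rmult_lt_0_compat.
have h2 : 2 * a * th ^ 2 <= e * th / 2 by nra.
have h3 : 2 * a * th ^ 2 * (INR n * L) <= e * th / 2 * (INR n * L) by apply: Rmult_le_compat_r; lra.
by rewrite /t; lra.
Qed.

Lemma signs_tail (e th : R) :
  0 < th -> th <= 1 / 2 -> 4 * a * th <= e -> 8 <= th * e * L ->
  Pr (fun A => exists2 s : {ffun 'I_n -> bool} * bool, true &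
     e * INR n * L <= sgn s.2 *
     bform (noise p q sigma A) (fun i => sgn (s.1 i)) (fun i => sgn (s.1 i)))
  <= 2 * exp (- L).
Proof.
move=> th0 th1 the hL; apply: Rle_trans (sbm_prob_exists p01 _ _) _.
(* Each exponent is at most [- 2 n]: one [n] pays for the [2 ^ n] sign vectors, the other exceeds
   [L]. *)
apply: Rle_trans (_ : \big[Rplus/0]_(s : {ffun 'I_n -> bool} * bool) exp (- 2 * INR n) <= _).
  apply: Rsum_le => s _; apply: Rle_trans (sign_tail s.1 s.2 th0 th1 the) _.
  by apply: exp_le_compat; nra.
rewrite Rsum_const card_prod card_ffun card_bool card_ord.
have -> : INR (muln (expn 2 n) 2) = 2 * \big[Rmult/1]_(i : 'I_n) 2.
  rewrite -multE mult_INR Rmult_comm; congr (_ * _).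
  rewrite big_const card_ord; elim: (n) => [//|k IH].
  by rewrite expnS -multE mult_INR IH.
have h1 : \big[Rmult/1]_(i : 'I_n) 2 <= exp (INR n).
  have -> : exp (INR n) = \big[Rmult/1]_(i : 'I_n) exp 1.
    by rewrite Rprod_exp Rsum_const_ord Rmult_1_r.
  by apply: Rprod_le => i _; have := exp_ineq1_le 1; lra.
have h2 : exp (INR n) * exp (- 2 * INR n) <= exp (- L).
  rewrite -exp_plus; apply: exp_le_compat.
  by have := exp_ineq1_le L; rewrite exp_ln //; lra.
rewrite Rmult_assoc; apply: Rmult_le_compat_l; first lra.
apply: Rle_trans h2; apply: Rmult_le_compat_r => //; first by have := exp_pos (- 2 * INR n); lra.
Qed.

Lemma dual_diag_tail (k lam x th : R) (v : 'I_n) :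
  INR #|[set i | sigma i]| = k -> 0 <= th ->
  let kv := if sigma v then k else INR n - k in
  Pr (fun A => dual_diag A sigma lam v <= x)
  <= exp (th * x + th * lam * sgn (sigma v) * (2 * k - INR n)
          + kv * p * (exp (- th) - 1) + (INR n - kv) * q * (exp th - 1) + p).
Proof.
move=> kE th0 kv; pose c j := - th * (sgn (sigma v) * sgn (sigma j)).
pose t := - th * x - th * lam * sgn (sigma v) * (2 * k - INR n).
apply: Rle_trans (Rle_trans _ _ _ _ (sbm_chernoff_row p01 v c t)) _.
  apply: sbm_prob_mono => // A _; rewrite /dual_diag sum_sgn kE => h.
  have -> : \rsum_j (c j * adjR A v j) = - th * (sgn (sigma v) * \rsum_j (adjR A v j * sgn (sigma j))).
    by rewrite -!Rsum_mull; apply: eq_bigr => j _; rewrite /c; ring.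
  by rewrite /t; nra.
apply: exp_le_compat.
pose f j := if sigma j == sigma v then p * (exp (- th) - 1) else q * (exp th - 1).
(* The sum is completed by [j = v]; removing that term again costs at most the final [+ p]. *)
have -> : \big[Rplus/0]_(j | j != v) (p_ v j * (exp (c j) - 1)) = \rsum_j f j - f v.
  rewrite [in RHS](bigD1 v) //=.
  have -> : \big[Rplus/0]_(j | j != v) (p_ v j * (exp (c j) - 1)) = \big[Rplus/0]_(j | j != v) f j.
    apply: eq_bigr => j _; rewrite /f /edge_prob eq_sym /c /sgn.
    by case: (sigma j); case: (sigma v) => /=; congr (_ * (exp _ - 1)); ring.
  by set s0 := bigop _ _ _; ring.
have fv : f v = p * (exp (- th) - 1) by rewrite /f eqxx.
have -> : \rsum_j f j = kv * p * (exp (- th) - 1) + (INR n - kv) * q * (exp th - 1).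
  transitivity (\rsum_j if sigma j then (if sigma v then p * (exp (- th) - 1) else q * (exp th - 1))
     else (if sigma v then q * (exp th - 1) else p * (exp (- th) - 1))).
    by apply: eq_bigr => j _; rewrite /f; case: (sigma j); case: (sigma v).
  by rewrite sum_affine_sgn kE /kv; case: (sigma v); ring.
rewrite fv /t.
have : 0 < exp (- th) by apply: exp_pos.
by nra.
Qed.

End Events.

(** * Exact recovery *)

(** Each of the four error terms gets at most [eps / 4]. The order avoids circularity: [del] from
    the degree term, [m] from [m / del], then [th] and [kap] from sparsity, [B] large in terms of
    [kap] and [del], and only then [e], which must beat [B ^ 2]. *)
Lemma spectral_parameters a eps : 0 < a -> 0 < eps ->
  exists m th kap B del, [/\ 0 < m, 0 <= th, th * m = 6 & kap * (a * exp th) <= 1] /\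
  exists e th', [/\ 0 < B, 0 < del <= 1, 1 <= kap * (del ^ 2 * B ^ 2),
     0 < th' <= 1 / 2 & [/\ 0 < e, 4 * a * th' <= e &
     B ^ 2 * e + 2 * a / B + 2 * del * (2 * a + 2) + m / del <= eps]].
Proof.
move=> a0 eps0; pose C := 2 * a + 2; have C0 : 0 < C by rewrite /C; lra.
pose del := Rmin 1 (eps / (8 * C)).
have d0 : 0 < del by apply: Rmin_glb_lt; [lra | apply: Rdiv_lt_0_compat; lra].
have d1 : del <= 1 by apply: Rmin_l.
have dC : del * C <= eps / 8.
  have h : del <= eps / (8 * C) by apply: Rmin_r.
  have -> : eps / 8 = eps / (8 * C) * C by field; lra.
  by apply: Rmult_le_compat_r; lra.
pose m := eps * del / 4; have m0 : 0 < m by rewrite /m; nra.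
pose th := 6 / m; have th0 : 0 < th by apply: Rdiv_lt_0_compat; lra.
have ae : 0 < a * exp th by apply: Rmult_lt_0_compat => //; apply: exp_pos.
pose kap := / (a * exp th); have kap0 : 0 < kap by apply: Rinv_0_lt_compat.
have kd : 0 < kap * del ^ 2 by apply: Rmult_lt_0_compat => //; nra.
have kdi := Rinv_0_lt_compat _ kd; have ai : 0 < 8 * a / eps by apply: Rdiv_lt_0_compat; lra.
pose B := 8 * a / eps + 1 + / (kap * del ^ 2).
have B1 : 1 <= B by rewrite /B; lra.
have B2 : 0 < B ^ 2 by nra.
pose e := eps / (4 * B ^ 2); have e0 : 0 < e by apply: Rdiv_lt_0_compat; lra.
have th'0 : 0 < Rmin (1 / 2) (e / (4 * a)).
  by apply: Rmin_glb_lt; [lra | apply: Rdiv_lt_0_compat; lra].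
exists m, th, kap, B, del; split; first split => //; try lra.
- by rewrite /th; field; lra.
- by rewrite /kap Rinv_l; lra.
exists e, (Rmin (1 / 2) (e / (4 * a))); split; try lra.
- have -> : kap * (del ^ 2 * B ^ 2) = (kap * del ^ 2 * B) * B by ring.
  have h : 1 <= kap * del ^ 2 * B.
    rewrite -(Rinv_r (kap * del ^ 2)); last lra.
    by apply: Rmult_le_compat_l; rewrite /B; lra.
  by nra.
- by split=> //; apply: Rmin_l.
split=> //.
  have h : Rmin (1 / 2) (e / (4 * a)) <= e / (4 * a) by apply: Rmin_r.
  have {2}-> : e = 4 * a * (e / (4 * a)) by field; lra.
  by apply: Rmult_le_compat_l; lra.
have -> : B ^ 2 * e = eps / 4 by rewrite /e; field; lra.
have -> : m / del = eps / 4 by rewrite /m; field; lra.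
have : 2 * a / B <= eps / 4.
  apply: (Rmult_le_reg_r B); first lra.
  have -> : 2 * a / B * B = eps / 4 * (8 * a / eps) by field; lra.
  by apply: Rmult_le_compat_l; rewrite /B; lra.
by rewrite -/C; lra.
Qed.

Section Recovery.

Variables (n K : nat) (a b r e0 eps : R) (sigma : 'I_n -> bool) (A : graph n).
Local Notation L := (ln (INR n)).
Local Notation p := (a * L / INR n).
Local Notation q := (b * L / INR n).
Local Notation T := (tau a b).

Lemma sdp_recovery (m kap B del e : R) :
  0 < b -> b < a -> 0 < INR n -> 0 < L -> adj_valid A -> #|[set i | sigma i]| = K ->
  0 < INR K -> 0 < INR n - INR K -> INR n <= r * INR K -> INR n <= r * (INR n - INR K) ->
  0 <= m -> 0 < B -> 0 < del <= 1 -> 1 <= kap * (del ^ 2 * B ^ 2) -> 0 <= eps ->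
  B ^ 2 * e + 2 * a / B + 2 * del * (2 * a + 2) + m / del <= eps ->
  eps * (4 * r + 2) < e0 -> eps * (4 * r + 2) < T - b ->
  (forall i, \rsum_j adjR A i j <= (2 * a + 2) * L) ->
  (forall U : 'I_n -> bool, \rsum_i indR (U i) <= kap * INR n ->
     edge_count A U <= m * L * \rsum_i indR (U i)) ->
  (forall s : 'I_n -> bool,
     Rabs (bform (noise p q sigma A) (fun i => sgn (s i)) (fun i => sgn (s i))) <= e * INR n * L) ->
  (forall i, e0 * L <= dual_diag A sigma (T * L / INR n) i) ->
  sdp_unique_opt K A (outer sigma).
Proof.
move=> b0 ba n0 L0 Av hK K0 nK rK rnK m0 B0 del01 kapB eps0 heps he0 hT hdeg hsp hsig hd.
have i0 : 0 < L / INR n by apply: Rdiv_lt_0_compat.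
have pE : p = a * (L / INR n) by field; lra.
have qE : q = b * (L / INR n) by field; lra.
have p0 : 0 < p by rewrite pE; nra.
have qp : 0 <= q <= p by rewrite pE qE; nra.
apply: (@sdp_certificate _ _ _ _ (dual_diag A sigma (T * L / INR n)) (T * L / INR n)) => //.
  by move=> i; apply: dual_slack_ker.
have kE : INR #|[set i | sigma i]| = INR K by rewrite hK.
have W_small x : Rabs (bform (noise p q sigma A) x x) <= eps * L * \rsum_i (x i) ^ 2.
  have := @noise_form_le n p q a L (2 * a + 2) m kap e B del sigma A n0 Av (Rlt_le _ _ L0) m0
    (conj (Rlt_le _ _ p0) (Rle_refl _)) qp B0 del01 kapB hdeg hsp hsig x.
  move=> h; apply: Rle_trans h _; apply: Rmult_le_compat_r.
    by apply: Rsum_ge0 => i _; apply: pow2_ge_0.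
  by rewrite (Rmult_comm eps); apply: Rmult_le_compat_l; lra.
move=> x xs xn0.
apply: (@dual_slack_pos n p q _ (eps * L) (e0 * L) r (INR K) sigma A) => //.
- by apply: Rmult_le_pos; lra.
- have : eps * (4 * r + 2) * L < e0 * L by apply: Rmult_lt_compat_r.
  by lra.
- have -> : INR n * (T * L / INR n - q) = (T - b) * L by field; lra.
  have : eps * (4 * r + 2) * L < (T - b) * L by apply: Rmult_lt_compat_r.
  by lra.
Qed.

End Recovery.

(** Rounding moves [k] from [rho N] by some [d] in [[0, 1]]; together with the missing diagonal term
    this changes the exponent by [O(L / N)], with constant [C]. The factor [1] stands for
    [sgn (sigma v)]. *)
Lemma diag_exponent_minority a b rho T th x L N k eta0 C :
  0 < a -> 0 < b -> 0 <= T -> 0 <= th -> 0 < N -> 0 < L -> rho * N <= k <= rho * N + 1 ->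
  - th * T * (1 - rho - rho) + rho * a * (exp (- th) - 1) + (1 - rho) * b * (exp th - 1) = - eta0 ->
  2 * th * T + a <= C ->
  th * (x * L) + th * (T * L / N) * 1 * (2 * k - N) + k * (a * L / N) * (exp (- th) - 1)
    + (N - k) * (b * L / N) * (exp th - 1) + a * L / N
  <= L * (- eta0 + th * x + C / N).
Proof.
move=> a0 b0 T0 th0 N0 L0 hk heta hC.
have F0 := exp_pos (- th); have E1 := exp_ineq1_le th.
have F1 : exp (- th) <= 1 by rewrite -exp_0; apply: exp_le_compat; lra.
pose d := (k - rho * N).
have -> : th * (x * L) + th * (T * L / N) * 1 * (2 * k - N) + k * (a * L / N) * (exp (- th) - 1)
    + (N - k) * (b * L / N) * (exp th - 1) + a * L / N =
   L * (- eta0 + th * x + (d * (2 * th * T + a * (exp (- th) - 1) - b * (exp th - 1)) + a) / N).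
  by rewrite -heta /d; field; lra.
apply: Rmult_le_compat_l; first lra.
apply: Rplus_le_compat_l; apply: Rmult_le_compat_r; first by have := Rinv_0_lt_compat _ N0; lra.
have thT : 0 <= 2 * th * T by apply: Rmult_le_pos; lra.
have d01 : 0 <= d <= 1 by rewrite /d; lra.
have h1 : 0 <= d * (a * (1 - exp (- th))) by apply: Rmult_le_pos; [lra | apply: Rmult_le_pos; lra].
have h2 : 0 <= d * (b * (exp th - 1)) by apply: Rmult_le_pos; [lra | apply: Rmult_le_pos; lra].
have h3 : 0 <= (1 - d) * (2 * th * T) by apply: Rmult_le_pos; lra.
lra.
Qed.

Lemma diag_exponent_majority a b rho T th x L N k eta0 C :
  0 < a -> 0 < b -> 0 <= T -> 0 <= th -> 0 < N -> 0 < L -> rho * N <= k <= rho * N + 1 ->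
  th * T * (1 - rho - rho) + (1 - rho) * a * (exp (- th) - 1) + rho * b * (exp th - 1) = - eta0 ->
  2 * a + b * exp th <= C ->
  th * (x * L) + th * (T * L / N) * -1 * (2 * k - N) + (N - k) * (a * L / N) * (exp (- th) - 1)
    + (N - (N - k)) * (b * L / N) * (exp th - 1) + a * L / N
  <= L * (- eta0 + th * x + C / N).
Proof.
move=> a0 b0 T0 th0 N0 L0 hk heta hC.
have F0 := exp_pos (- th); have E1 := exp_ineq1_le th.
pose d := (k - rho * N).
have -> : th * (x * L) + th * (T * L / N) * -1 * (2 * k - N) + (N - k) * (a * L / N) * (exp (- th) - 1)
    + (N - (N - k)) * (b * L / N) * (exp th - 1) + a * L / N =
   L * (- eta0 + th * x + (d * (- (2 * th * T) - a * (exp (- th) - 1) + b * (exp th - 1)) + a) / N).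
  by rewrite -heta /d; field; lra.
apply: Rmult_le_compat_l; first lra.
apply: Rplus_le_compat_l; apply: Rmult_le_compat_r; first by have := Rinv_0_lt_compat _ N0; lra.
have thT : 0 <= 2 * th * T by apply: Rmult_le_pos; lra.
have d01 : 0 <= d <= 1 by rewrite /d; lra.
have h1 : 0 <= d * (a * exp (- th)) by apply: Rmult_le_pos; [lra | apply: Rmult_le_pos; lra].
have h2 : 0 <= (1 - d) * (b * (exp th - 1)) by apply: Rmult_le_pos; [lra | apply: Rmult_le_pos; lra].
have h3 : 0 <= d * (2 * th * T) by apply: Rmult_le_pos; lra.
have h4 : 0 <= (1 - d) * a by apply: Rmult_le_pos; lra.
lra.
Qed.

Theorem theorem1 (a b rho : R) :
  0 < b -> b < a -> 0 <= rho <= 1 / 2 -> eta rho a b > 1 ->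
  exists c : R, 0 < c /\
  exists N : nat, forall (n K : nat), leq N n ->
    (INR K - 1 < rho * INR n <= INR K) ->
    forall sigma : 'I_n -> bool, #|[set i | sigma i]| = K ->
      sbm_prob a b sigma (fun A => sdp_unique_opt K A (outer sigma))
        >= 1 - Rpower (INR n) (- c).
Proof.
move=> b0 ba [[rho0|<-] rho_le] eta1; last first.
  (* The case [rho = 0]: the ceiling gives [K = 0], the event is certain, and the rate 1 is
     arbitrary. *)
  exists 1; split; first lra; exists O => n K _ [hK _] sigma hs.
  have K0 : K = O by case: (K) hK => // K'; rewrite S_INR; have := pos_INR K'; lra.
  apply: Rle_ge; have -> : sbm_prob a b sigma (fun A => sdp_unique_opt K A (outer sigma)) = 1.
    rewrite -(sbm_mass_sum a b sigma); apply: eq_bigr => A _.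
    case: excluded_middle_informative => // h; case: h.
    by rewrite K0; apply: sdp_unique_opt_extreme; rewrite hs.
  by set x := Rpower _ _; have : 0 < x by [apply: exp_pos]; lra.
have a0 : 0 < a by lra.
have [bT Ta] := tau_bounds b0 ba; set T := tau a b in bT Ta.
have [th1 th1_ge0 f1] := exponent_minority b0 ba rho0 rho_le.
have [th2 th2_ge0 f2] := exponent_majority b0 ba rho0 rho_le.
set et := eta rho a b in eta1 f1 f2.
(* Budget for the gap [et - 1]: a quarter for the threshold [e0], a quarter for rounding, and the
   remaining half for the rate [2 * c] beyond the union bound. *)
pose e0 := (et - 1) / (4 * (th1 + th2 + 1)).
have e0_gt0 : 0 < e0 by apply: Rdiv_lt_0_compat; lra.
have e0E : e0 * (th1 + th2 + 1) = (et - 1) / 4 by rewrite /e0; field; lra.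
(* [/ rho] handles the small cluster; 4 handles the large one, as [n - K >= n / 2 - 1 >= n / 4] for
   [n >= 4]. *)
have ri := Rinv_0_lt_compat _ rho0; pose r := / rho + 4.
pose eps := Rmin e0 (T - b) / (8 * r + 8).
have mn : 0 < Rmin e0 (T - b) by apply: Rmin_glb_lt; lra.
have eps_gt0 : 0 < eps by apply: Rdiv_lt_0_compat; rewrite /r; lra.
have eps_lt : eps * (4 * r + 2) < Rmin e0 (T - b).
  have -> : Rmin e0 (T - b) = eps * (8 * r + 8) by rewrite /eps; field; rewrite /r; lra.
  by apply: Rmult_lt_compat_l => //; rewrite /r; lra.
have [m [th3 [kap [B [del [[m0 th3_ge0 thm hkap]
  [e [th4 [B0 del01 kapB th4_01 [e_gt0 hth4 heps]]]]]]]]]] :=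
  spectral_parameters a0 eps_gt0.
pose C0 := 2 * th1 * T + 2 * a + b * exp th2.
have C1 : 0 <= 2 * th1 * T by apply: Rmult_le_pos; lra.
have C2 : 0 < b * exp th2 by apply: Rmult_lt_0_compat => //; apply: exp_pos.
pose c := Rmin ((et - 1) / 4) (1 / 2).
have c_gt0 : 0 < c by apply: Rmin_glb_lt; lra.
have c_l : c <= (et - 1) / 4 by apply: Rmin_l.
have c_r : c <= 1 / 2 by apply: Rmin_r.
have te : 0 < th4 * e by apply: Rmult_lt_0_compat; lra.
have M1 : 0 < 4 * C0 / (et - 1) by apply: Rdiv_lt_0_compat; rewrite /C0; lra.
have M2 : 0 < 8 / (th4 * e) by apply: Rdiv_lt_0_compat; lra.
have M3 : 0 < 7 / c by apply: Rdiv_lt_0_compat; lra.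
(* One summand per demand on [ln n]: [n >= 4], [p <= 1], the rounding error, the union over sign
   vectors, and the constant factor 7 of the final estimate. *)
pose M := 4 + 4 * a + 4 * C0 / (et - 1) + 8 / (th4 * e) + 7 / c.
exists c; split => //; have [N hN] := INR_unbounded (exp M).
exists N => n K Nn [hK1 hK2] sigma hs.
have nM : exp M < INR n by have := le_INR _ _ (leP Nn); lra.
have n_gt0 : 0 < INR n by have := exp_pos M; lra.
have LM : M < ln (INR n) by rewrite -(ln_exp M); apply: ln_increasing => //; apply: exp_pos.
set L := ln (INR n) in LM; have L_gt0 : 0 < L by rewrite /M in LM; lra.
have nE : INR n = exp L by rewrite /L exp_ln.
have nL : 1 + L <= INR n by rewrite nE; apply: exp_ineq1_le.
have n4 : 4 <= INR n by rewrite /M in LM; lra.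
have p_le1 : a * L / INR n <= 1.
  apply: (Rmult_le_reg_r (INR n)) => //; rewrite Rmult_1_l.
  have -> : a * L / INR n * INR n = a * L by field; lra.
  have -> : INR n = exp (L / 2) * exp (L / 2) by rewrite -exp_plus nE; congr exp; field.
  have h := exp_ineq1_le (L / 2); have La : 4 * a <= L by rewrite /M in LM; lra.
  by nra.
have hL1 : C0 / INR n <= (et - 1) / 4.
  apply: (Rmult_le_reg_r (INR n)) => //.
  have -> : C0 / INR n * INR n = (et - 1) / 4 * (4 * C0 / (et - 1)) by field; lra.
  by apply: Rmult_le_compat_l; [lra | rewrite /M in LM; lra].
have hL2 : 8 <= th4 * e * L.
  have {1}-> : 8 = th4 * e * (8 / (th4 * e)) by field; lra.
  by apply: Rmult_le_compat_l; [lra | rewrite /M in LM; lra].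
have hL3 : 7 <= c * L.
  have {1}-> : 7 = c * (7 / c) by field; lra.
  by apply: Rmult_le_compat_l; [lra | rewrite /M in LM; lra].
have K_gt0 : 0 < INR K by have := Rmult_lt_0_compat _ _ rho0 n_gt0; lra.
have rhon : rho * INR n <= INR n / 2 by nra.
have nK : INR n / 4 <= INR n - INR K by lra.
have rK : INR n <= r * INR K.
  have h : / rho * (rho * INR n) = INR n by field; lra.
  have : / rho * (rho * INR n) <= / rho * INR K by apply: Rmult_le_compat_l; lra.
  by rewrite /r; lra.
have rnK : INR n <= r * (INR n - INR K) by rewrite /r; nra.
have p01 := edge_prob_bounds sigma b0 ba n_gt0 L_gt0.
have {}p01 i j : 0 <= edge_prob a b sigma i j <= 1 by have := p01 i j; rewrite -/L; lra.
pose lam := T * L / INR n.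
pose bad_deg := fun A : graph n => exists2 i, true & (2 * a + 2) * L <= \rsum_j adjR A i j.
pose bad_sparse := fun A : graph n => exists2 U : {ffun 'I_n -> bool}, [exists i, U i] &
  \rsum_i indR (U i) <= kap * INR n /\ m * L * \rsum_i indR (U i) <= edge_count A U.
pose bad_sign := fun A : graph n => exists2 s : {ffun 'I_n -> bool} * bool, true &
  e * INR n * L <= sgn s.2 * bform (noise (a * L / INR n) (b * L / INR n) sigma A)
                               (fun i => sgn (s.1 i)) (fun i => sgn (s.1 i)).
pose bad_diag := fun A : graph n => exists2 v, true & dual_diag A sigma lam v <= e0 * L.
pose Pr := sbm_prob a b sigma.
have P1 : Pr bad_deg <= exp (- L) := degree_tail sigma b0 ba n_gt0 L_gt0 p_le1.
have P2 : Pr bad_sparse <= 3 * exp (- L) :=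
  sparse_tail sigma b0 ba n_gt0 L_gt0 p_le1 m0 thm th3_ge0 hkap.
have P3 : Pr bad_sign <= 2 * exp (- L) :=
  signs_tail sigma b0 ba n_gt0 L_gt0 p_le1 (proj1 th4_01) (proj2 th4_01) hth4 hL2.
have P4 : Pr bad_diag <= exp (- 2 * c * L).
  apply: Rle_trans (sbm_prob_exists p01 _ _) _.
  apply: Rle_trans (_ : \big[Rplus/0]_(v : 'I_n) exp (- (1 + 2 * c) * L) <= _); last first.
    by rewrite Rsum_const_ord exp_INR_ln // -/L; apply: exp_le_compat; lra.
  apply: Rsum_le => v _.
  have kE : INR #|[set i | sigma i]| = INR K by rewrite hs.
  have hk : rho * INR n <= INR K <= rho * INR n + 1 by lra.
  have fin th x : x <= L * (- et + th * e0 + C0 / INR n) -> 0 <= th <= th1 + th2 ->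
      exp x <= exp (- (1 + 2 * c) * L).
    move=> hx hth; apply: exp_le_compat; apply: Rle_trans hx _.
    rewrite Rmult_comm; apply: Rmult_le_compat_r; first lra.
    by have : th * e0 <= (th1 + th2) * e0 by [apply: Rmult_le_compat_r; lra]; lra.
  case E: (sigma v).
    have := dual_diag_tail b0 ba n_gt0 L_gt0 p_le1 lam (e0 * L) v kE th1_ge0.
    rewrite E /= => h; apply: Rle_trans h _; apply: (fin th1); last lra.
    by apply: diag_exponent_minority f1 _ => //; rewrite -/T ?/C0; lra.
  have := dual_diag_tail b0 ba n_gt0 L_gt0 p_le1 lam (e0 * L) v kE th2_ge0.
  rewrite E /= => h; apply: Rle_trans h _; apply: (fin th2); last lra.
  by apply: diag_exponent_majority f2 _ => //; rewrite -?/T ?/C0; lra.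
rewrite sbm_probC; apply: Rle_ge; apply: Rplus_le_compat_l; apply: Ropp_le_contravar.
apply: Rle_trans (_ : Pr bad_deg + (Pr bad_sparse + (Pr bad_sign + Pr bad_diag)) <= _).
  apply: Rle_trans (_ : Pr (fun A => bad_deg A \/ (bad_sparse A \/ (bad_sign A \/ bad_diag A))) <= _).
    apply: sbm_prob_mono => // A Av nrec; apply: NNPP => good; apply: nrec.
    have [g1 [g2 [g3 g4]]] : ~ bad_deg A /\ ~ bad_sparse A /\ ~ bad_sign A /\ ~ bad_diag A by tauto.
    apply: (@sdp_recovery n K a b r e0 eps sigma A m kap B del e) => //; try lra.
    - by apply: Rlt_le_trans eps_lt _; apply: Rmin_l.
    - by apply: Rlt_le_trans eps_lt _; apply: Rmin_r.
    - by move=> i; apply: Rnot_lt_le => h; apply: g1; exists i => //; apply: Rlt_le.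
    - move=> U hU; apply: Rnot_lt_le => h; apply: g2.
      pose U' := [ffun i => U i].
      have UE i : U' i = U i by rewrite ffunE.
      have sE : \rsum_i indR (U' i) = \rsum_i indR (U i) by apply: eq_bigr => i _; rewrite UE.
      have cE : edge_count A U' = edge_count A U.
        by apply: eq_bigr => i _; apply: eq_bigr => j _; rewrite !UE.
      exists U'; last by rewrite sE cE; split=> //; apply: Rlt_le.
      (* The empty set cannot violate sparsity strictly: both sides are 0. *)
      apply: contraT; rewrite negb_exists => /forallP U0.
      move: h; rewrite -sE -cE /edge_count.
      have z i : indR (U' i) = 0 by rewrite (negbTE (U0 i)).
      rewrite big1 ?[X in _ < X]big1; first lra.
        by move=> i _; rewrite big1 // => j _; rewrite z; ring.
      by move=> i _; apply: z.
    - move=> s; apply: Rnot_lt_le => h; apply: g3.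
      pose s' := [ffun i => s i].
      have sE i : sgn (s' i) = sgn (s i) by rewrite ffunE.
      exists (s', Rltb 0 (bform (noise (a * L / INR n) (b * L / INR n) sigma A)
        (fun i => sgn (s i)) (fun i => sgn (s i)))) => //=.
      rewrite (bform_ext _ (x' := fun i => sgn (s i)) (y' := fun i => sgn (s i))) //.
      by move: h; rewrite -/L /sgn; case: RltbP; split_Rabs; lra.
    - by move=> i; apply: Rnot_lt_le => h; apply: g4; exists i => //; apply: Rlt_le.
  apply: Rle_trans (sbm_prob_or p01 _ _) _; apply: Rplus_le_compat_l.
  apply: Rle_trans (sbm_prob_or p01 _ _) _; apply: Rplus_le_compat_l.
  exact: sbm_prob_or.
(* The bounds add up to [1 + 3 + 2 + 1 = 7] copies of [exp (- 2 c L)], using [c <= 1 / 2]; the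
   factor 7 is absorbed by [exp (c L)], at the price of half the rate. *)
have h1 : exp (- L) <= exp (- 2 * c * L) by apply: exp_le_compat; nra.
apply: Rle_trans (_ : exp (c * L) * exp (- 2 * c * L) <= _); last first.
  by rewrite /Rpower -exp_plus -/L; apply: exp_le_compat; lra.
have h2 := exp_ineq1_le (c * L); have h3 := exp_pos (- 2 * c * L).
nra.
Qed.
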